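(* Let $\varphi\in A_\infty(\Omega)$ be a Musielak–Orlicz function of uniformly lower type $p_\varphi^-$ and uniformly upper type $p_\varphi^+$ with $q(\varphi)<p_\varphi^-\le p_\varphi^+<\infty$. Then for every $r\in(1,\infty)$ there is $C>0$ such that for every sequence $(g_k)_{k\in\mathbb N}$ of nonnegative $\mathcal F$-measurable functions, $$\Big\|\Big\{\sum_{k\in\mathbb N}[\mathbb E_k(g_k)]^r\Big\}^{1/r}\Big\|_{L^\varphi(\Omega)}\le C\Big\|\Big(\sum_{k\in\mathbb N}g_k^r\Big)^{1/r}\Big\|_{L^\varphi(\Omega)}.$$
   Context: Let $(\Omega,\mathcal F,\mathbb P)$ be a probability space, $(\mathcal F_n)_{n\in\mathbb Z_+}$ a nondecreasing sequence of sub-$\sigma$-algebras of $\mathcal F$, and $\mathbb E_n$ the conditional expectation w.r.t. $\mathcal F_n$. A Musielak–Orlicz function is $\varphi:\Omega\times[0,\infty)\to[0,\infty)$ with $\varphi(x,\cdot)$ nondecreasing, $\varphi(x,0)=0$, $\lim_{t\to\infty}\varphi(x,t)=\infty$ for each $x$ and $\varphi(\cdot,t)$ measurable (positive, integrable) for each $t$. $\|f\|_{L^\varphi(\Omega)}:=\inf\{\lambda>0:\int_\Omega\varphi(x,|f(x)|/\lambda)\,d\mathbb P\le1\}$. Uniformly lower (upper) type $p$: $\varphi(x,st)\le Cs^p\varphi(x,t)$ for all $x$, $t\ge0$, $s\in(0,1)$ (resp. $s\ge1$). For $q>1$, $\varphi\in A_q(\Omega)$ if $\sup_{t>0}\mathbb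 E_n(\varphi(\cdot,t))[\mathbb E_n(\varphi(\cdot,t)^{-1/(q-1)})]^{q-1}\le K$ a.e. for all $n$; $\varphi\in A_1(\Omega)$ if $\sup_{t>0}\mathbb E_n(\varphi(\cdot,t))/\varphi(\cdot,t)\le K$ a.e.; $A_\infty(\Omega)=\bigcup_{q\ge1}A_q(\Omega)$; $q(\varphi):=\inf\{q\ge1:\varphi\in A_q(\Omega)\}$. *)

(* Defs.v *)
From HB Require Import structures.
From mathcomp Require Import all_boot all_order all_algebra.
From mathcomp Require Import all_classical all_reals all_analysis measurable_realfun.
Set Implicit Arguments. Unset Strict Implicit. Unset Printing Implicit Defensive.
Import Order.TTheory GRing.Theory Num.Theory.
Import numFieldNormedType.Exports.
Local Open Scope classical_set_scope.
Local Open Scope ring_scope.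

Section defs.
Context {d : measure_display} {T : measurableType d} {R : realType}.
Variable P : probability T R.

Definition filtration (F : nat -> set (set T)) : Prop :=
  [/\ forall n, sigma_algebra setT (F n),
      forall n, F n `<=` measurable &
      forall n m, (n <= m)%N -> F n `<=` F m].

Definition sub_measurable (G : set (set T)) (h : T -> \bar R) : Prop :=
  forall B : set (\bar R), measurable B -> G (h @^-1` B).

Definition is_cond_exp (G : set (set T)) (f h : T -> \bar R) : Prop :=
  [/\ sub_measurable G h, (forall x, (0 <= h x)%E) &
      forall A, G A -> (\int[P]_(x in A) h x = \int[P]_(x in A) f x)%E].

Definition cond_exp_family (F : nat -> set (set T))
  (E : nat -> (T -> \bar R) -> T -> \bar R) : Prop :=
  forall n (f : T -> \bar R), measurable_fun setT f -> (forall x, (0 <= f x)%E) ->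
    is_cond_exp (F n) f (E n f).

Definition MO_function (phi : T -> R -> R) : Prop :=
  [/\ forall x, {in `[0, +oo[ &, nondecreasing (phi x)},
      forall x, phi x 0 = 0,
      forall x, phi x t @[t --> +oo] --> +oo,
      forall t, 0 <= t -> measurable_fun setT (fun x => phi x t) &
      forall t, 0 < t -> (forall x, 0 < phi x t) /\
                         P.-integrable setT (fun x => (phi x t)%:E)].

Definition unif_lower_type (phi : T -> R -> R) (p : R) : Prop :=
  exists C : R, 0 < C /\ forall x t s, 0 <= t -> 0 < s < 1 ->
    phi x (s * t) <= C * s `^ p * phi x t.

Definition unif_upper_type (phi : T -> R -> R) (p : R) : Prop :=
  exists C : R, 0 < C /\ forall x t s, 0 <= t -> 1 <= s ->
    phi x (s * t) <= C * s `^ p * phi x t.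

Local Open Scope ereal_scope.

Definition A1 (E : nat -> (T -> \bar R) -> T -> \bar R) (phi : T -> R -> R) :=
  exists K : R, forall n, {ae P, forall x, forall t : R, (0 < t)%R ->
    E n (fun y => (phi y t)%:E) x * ((phi x t)^-1)%:E <= K%:E}.

Definition Aq (E : nat -> (T -> \bar R) -> T -> \bar R) (phi : T -> R -> R) (q : R) :=
  exists K : R, forall n, {ae P, forall x, forall t : R, (0 < t)%R ->
    E n (fun y => (phi y t)%:E) x *
    (E n (fun y => ((phi y t) `^ (- (q - 1)^-1))%:E) x) `^ (q - 1) <= K%:E}.

Definition in_A (E : nat -> (T -> \bar R) -> T -> \bar R) (phi : T -> R -> R) (q : R) :=
  (q = 1%R /\ A1 E phi) \/ ((1 < q)%R /\ Aq E phi q).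

Definition in_A_infty E phi := exists q : R, (1 <= q)%R /\ in_A E phi q.

Definition q_index E phi : \bar R :=
  ereal_inf [set q%:E | q in [set q : R | (1 <= q)%R /\ in_A E phi q]].

Definition phi_ext (phi : T -> R -> R) (x : T) (y : \bar R) : \bar R :=
  match y with
  | r%:E => (phi x `|r|)%:E
  | _ => +oo
  end.

Definition Lphi_norm (phi : T -> R -> R) (f : T -> \bar R) : \bar R :=
  ereal_inf [set lam%:E | lam in [set lam : R | (0 < lam)%R /\
     \int[P]_x phi_ext phi x (f x * (lam^-1)%:E) <= 1]].

End defs.

(* Main.v *)
Require Import Defs.
From HB Require Import structures.
From mathcomp Require Import all_boot all_order all_algebra.
From mathcomp Require Import all_classical all_reals all_analysis measurable_realfun.
From mathcomp Require Import ring lra.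
Set Implicit Arguments. Unset Strict Implicit. Unset Printing Implicit Defensive.
Import Order.TTheory GRing.Theory Num.Theory.
Import numFieldNormedType.Exports.
Local Open Scope classical_set_scope.
Local Open Scope ring_scope.

(** Each weight [phi(., t)] lies in the martingale class A_p for every p above
    some q < pm, with constants independent of t.  For a weight w in A_p and any
    r <> p, the map (g_k) |-> (E_k g_k) is of weak type (p, p) from L^p(w; l^r)
    to L^p(w; l^r).  For p < r this follows from the three-factor Hoelder bound
    (E_k g)^r <= C E_k(g^r U^(p-r) w) / E_k(w) * (M U)^(r-p), where
    U = (sum g_k^r)^(1/r) and M is the maximal operator; for r < p it follows by
    testing against the indicator of a level set.  Both need the weighted Doob
    inequality, which holds for all A_p weights (no self-improvement of A_p,
    false for general filtrations, is used).  Interpolating between one exponent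
    in ]q, pm[ and one above max(pp, r), with phi(., t) as the weight at level t,
    gives the modular inequality, and the lower type turns it into the norm
    inequality. *)

(** * Dyadic sums *)

(** A conditional expectation is given only up to null sets, so pointwise inequalities can be passed
    under it only countably many at a time. Hoelder's inequality is therefore recovered from Young's
    inequality at the powers of 2, at the price of a constant. The same powers discretise phi: up to
    a constant, the modular of y is at most the sum over i of the integral of phi(., 2^i) over {y >
    2^i}. Each summand involves one fixed weight, which is why weighted estimates uniform in t are
    enough although phi varies in both variables. Two exponents are needed because two geometric
    sums must converge: an exponent below pm for the levels under the value of the function, one
    above pp for the levels over it. The exponent p = r is avoided because both weak-type arguments
    degenerate there: in one the Young exponent p/r becomes 1, in the other the Hoelder weight
    (r-p)/(r-1) becomes 0. Interpolation leaves enough freedom to choose other exponents. *)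

Section dyadic.
Context {R : realType}.

(* [dexp] enumerates the integers, so [dyad] enumerates all powers of 2. *)
Definition dexp (i : nat) : int := if odd i then Negz i./2 else Posz i./2.
Definition dyad (i : nat) : R := 2 ^ (dexp i).

Lemma dyad_gt0 i : 0 < dyad i.
Proof. by rewrite /dyad exprz_gt0. Qed.

Lemma dyad_between (y : R) : 0 < y -> exists i, dyad i < y <= 2 * dyad i.
Proof.
move=> y0; have l2 : 0 < ln (2 : R) by rewrite ln_gt0 // ltr1n.
(* Ceiling minus one rather than the floor: the left inequality must be strict, to match level sets
   of the form [t < y x]. *)
pose j := (Num.ceil (ln y / ln 2) - 1)%R.
have /andP[jl ju] : j%:~R < ln y / ln 2 <= j%:~R + 1.
  by have := ceil_itv (ln y / ln 2); rewrite /j intrD mulrNz subrK.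
have pE (z : int) : (2 : R) ^ z = expR (z%:~R * ln 2).
  by rewrite -powR_intmul// /powR pnatr_eq0.
have [i ij] : exists i, dexp i = j.
  case: (j) => k; first by exists k.*2; rewrite /dexp odd_double doubleK.
  by exists k.*2.+1; rewrite /dexp/= odd_double uphalf_double.
exists i; rewrite /dyad ij pE; apply/andP; split.
  by rewrite -[ltRHS]lnK // ltr_expR -ltr_pdivlMr.
have -> : 2 * expR (j%:~R * ln 2) = expR ((j%:~R + 1) * ln 2) :> R.
  by rewrite [in RHS]mulrDl mul1r expRD lnK ?posrE// mulrC.
by rewrite -[leLHS]lnK // ler_expR -ler_pdivrMr.
Qed.

(** The first 2n values of [dexp] are exactly the integers from -n to n - 1, so partial sums of even
    length telescope. *)
Lemma dyad_telescope (f h : int -> R) : (forall j, f j <= h (j + 1) - h j) ->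
  forall n, \sum_(0 <= i < n.*2) f (dexp i) <= h n%:Z - h (- n%:Z).
Proof.
move=> fh; elim=> [|n IH]; first by rewrite big_nil subrr.
rewrite doubleS big_nat_recr//= big_nat_recr//=.
have -> : dexp n.*2 = n by rewrite /dexp odd_double doubleK.
have -> : dexp n.*2.+1 = Negz n by rewrite /dexp /= odd_double uphalf_double.
have := fh n; have := fh (Negz n).
have -> : Negz n + 1 = - n%:Z by rewrite NegzE -addn1 PoszD opprD subrK.
have -> : n%:Z + 1 = n.+1%:Z by rewrite -PoszD addn1.
have -> : - n.+1%:Z = Negz n by rewrite NegzE.
move: IH; set a := h _; set b := h _; set c := h _; set e := h _.
set S := \sum_(_ <= _ < _) _ => IH h1 h2.
rewrite (le_trans (lerD (lerD IH h2) h1))// le_eqVlt; apply/orP; left; apply/eqP.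
ring.
Qed.

Lemma dyad_sum (f : nat -> \bar R) (c : \bar R) : (forall i, (0 <= f i)%E) ->
  (forall n, (\sum_(0 <= i < n.*2) f i <= c)%E) -> (\sum_(i <oo) f i <= c)%E.
Proof.
move=> f0 h; apply: lime_le; first exact: is_cvg_nneseries.
apply: nearW => n; apply: le_trans (h n); apply: lee_sum_nneg_natr => //.
by rewrite -addnn leq_addr.
Qed.

Lemma dyad_pow_pred (s : R) (j : int) :
  ((2 : R) ^ (j - 1)) `^ s = (2 `^ s)^-1 * (2 ^ j) `^ s.
Proof.
rewrite expfzDr ?pnatr_eq0// powRM ?exprz_ge0// mulrC; congr (_ * _).
by rewrite -invr_expz expr1z -powRN -mulN1r powRrM powR_inv1.
Qed.

Lemma dyad_sum_below (s u : R) : 0 < s -> 0 < u ->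
  (\sum_(i <oo) ((dyad i <= u)%R%:R * dyad i `^ s)%:E
   <= ((1 - (2 `^ s)^-1)^-1 * u `^ s)%:E)%E.
Proof.
move=> s0 u0.
have p1 : 1 < (2 : R) `^ s.
  by have := @gt0_ltr_powR R _ s0 1 2; rewrite powR1; apply; rewrite ?nnegrE ?ltr1n.
have c0 : 0 < 1 - ((2 : R) `^ s)^-1.
  by rewrite subr_gt0 invf_lt1// (lt_trans _ p1).
apply: dyad_sum => [i|n]; first by rewrite lee_fin mulr_ge0 ?powR_ge0.
rewrite sumEFin lee_fin mulrC ler_pdivlMr// mulr_suml.
(* A discrete primitive of the truncated geometric series: as long as 2^j <= u its increment is (1 -
   2^-s) 2^(js), afterwards it is nonnegative, and h never exceeds u^s. *)
pose h (j : int) := (Num.min ((2 : R) ^ (j - 1)) u) `^ s.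
have m0 j : 0 <= Num.min ((2 : R) ^ j) u by rewrite le_min exprz_ge0// ltW.
apply: (@le_trans _ _ (h n%:Z - h (- n%:Z))).
  refine (@dyad_telescope
    (fun j => (2 ^ j <= u :> R)%R%:R * (2 ^ j) `^ s * (1 - (2 `^ s)^-1)) h _ n).
  move=> j; rewrite /h addrK; have [ju|ju] := leP (2 ^ j) u.
    have j1u : (2 : R) ^ (j - 1) <= 2 ^ j.
      by rewrite ler_weXz2l ?ler1n// gerBl.
    by rewrite !min_l ?(le_trans j1u)//= dyad_pow_pred mul1r mulrBr mulr1 mulrC.
  rewrite mul0r mul0r subr_ge0.
  by rewrite ge0_ler_powR ?nnegrE ?(ltW s0) ?(ltW u0)// ge_min lexx orbT.
rewrite /h lerBlDr (@le_trans _ _ (u `^ s))//; last by rewrite lerDl powR_ge0.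
by rewrite ge0_ler_powR ?nnegrE ?(ltW s0) ?(ltW u0)// ge_min lexx orbT.
Qed.

Lemma dyad_sum_above (s u : R) : 0 < s -> 0 < u ->
  (\sum_(i <oo) ((u <= dyad i)%R%:R * dyad i `^ (- s))%:E
   <= ((1 - (2 `^ s)^-1)^-1 * u `^ (- s))%:E)%E.
Proof.
move=> s0 u0.
have p1 : 1 < (2 : R) `^ s.
  by have := @gt0_ltr_powR R _ s0 1 2; rewrite powR1; apply; rewrite ?nnegrE ?ltr1n.
have c0 : 0 < 1 - ((2 : R) `^ s)^-1.
  by rewrite subr_gt0 invf_lt1// (lt_trans _ p1).
apply: dyad_sum => [i|n]; first by rewrite lee_fin mulr_ge0 ?powR_ge0.
rewrite sumEFin lee_fin mulrC ler_pdivlMr// mulr_suml.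
(* The mirror primitive: the minus sign makes it nondecreasing, and - h (- n) is at most u^-s. *)
pose h (j : int) := - (Num.max ((2 : R) ^ j) u) `^ (- s).
have m0 j : 0 < Num.max ((2 : R) ^ j) u by rewrite lt_max u0 orbT.
have mono (a b : R) : 0 < a -> a <= b -> b `^ (- s) <= a `^ (- s).
  move=> a0 ab; have b0 := lt_le_trans a0 ab.
  rewrite !powRN lef_pV2 ?posrE ?powR_gt0//.
  by rewrite ge0_ler_powR ?nnegrE ?(ltW s0) ?(ltW a0) ?(ltW b0).
apply: (@le_trans _ _ (h n%:Z - h (- n%:Z))).
  refine (@dyad_telescope
    (fun j => (u <= 2 ^ j :> R)%R%:R * (2 ^ j) `^ (- s) * (1 - (2 `^ s)^-1)) h _ n).
  move=> j; rewrite /h opprK; have [ju|ju] := leP u (2 ^ j).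
    have j1u : (2 : R) ^ j <= 2 ^ (j + 1).
      by rewrite ler_weXz2l ?ler1n// lerDl.
    rewrite !max_l ?(le_trans ju)//= mul1r.
    have := dyad_pow_pred (- s) (j + 1); rewrite addrK => ->.
    rewrite (powRN 2 s) invrK mulrBr mulr1 [in leLHS]mulrAC mulfV ?gt_eqF ?powR_gt0//.
    by rewrite mul1r addrC.
  rewrite mul0r mul0r addrC subr_ge0 mono//.
  by rewrite le_max lexx orbT.
rewrite /h opprK addrC lerBlDr (@le_trans _ _ (u `^ (- s)))//; last by rewrite lerDl powR_ge0.
by rewrite mono// le_max lexx orbT.
Qed.

End dyadic.
(** * Nonnegative measurable functions *)

Section nonneg_measurable.
Context {d : measure_display} {T : measurableType d} {R : realType}.
Local Open Scope ereal_scope.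

Definition nnm (f : T -> \bar R) := measurable_fun setT f /\ forall x, 0 <= f x.

Lemma nnmM f g : nnm f -> nnm g -> nnm (fun x => f x * g x).
Proof.
by move=> [mf f0] [mg g0]; split=> [|x]; [exact: emeasurable_funM|rewrite mule_ge0].
Qed.

Lemma nnmD f g : nnm f -> nnm g -> nnm (fun x => f x + g x).
Proof.
by move=> [mf f0] [mg g0]; split=> [|x]; [exact: emeasurable_funD|rewrite adde_ge0].
Qed.

Lemma nnm_cst (c : \bar R) : 0 <= c -> nnm (fun=> c).
Proof. by move=> c0; split=> //; exact: measurable_cst. Qed.

Lemma nnm_pow f (s : R) : nnm f -> nnm (fun x => f x `^ s).
Proof.
move=> [mf f0]; split=> [|x]; last exact: poweR_ge0.
exact: (measurableT_comp (measurable_poweR s)).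
Qed.

Lemma nnm_EFin (f : T -> R) : measurable_fun setT f -> (forall x, (0 <= f x)%R) ->
  nnm (fun x => (f x)%:E).
Proof. by move=> mf f0; split=> [|x]; [exact/measurable_EFinP|rewrite lee_fin]. Qed.

Lemma nnm_indic (A : set T) : measurable A -> nnm (fun x => (\1_A x)%:E).
Proof.
by move=> mA; apply: nnm_EFin => // x; rewrite indicE ler0n.
Qed.

Lemma nnm_sum (f : nat -> T -> \bar R) : (forall k, nnm (f k)) ->
  nnm (fun x => \sum_(k <oo) f k x).
Proof.
move=> hf; split=> [|x]; last by apply: nneseries_ge0 => k _ _; exact: (hf k).2.
by apply: ge0_emeasurable_sum => [k x _ _|k _]; [exact: (hf k).2|exact: (hf k).1].
Qed.

Lemma nnm_sup (f : nat -> T -> \bar R) : (forall k, nnm (f k)) ->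
  nnm (fun x => ereal_sup (range (f^~ x))).
Proof.
move=> hf; split=> [|x]; last first.
  by apply: (le_trans ((hf 0%N).2 x)); apply: ereal_sup_ubound; exists 0%N.
have := measurable_fun_esups (D := setT) (fun n => (hf n).1) 0%N.
apply: eq_measurable_fun => x _; rewrite /esups /sdrop; congr ereal_sup.
by apply/seteqP; split=> y [k] _ <-; exists k.
Qed.

Lemma nnm_if (b : T -> bool) (f : T -> \bar R) : measurable_fun setT b -> nnm f ->
  nnm (fun x => if b x then f x else 0).
Proof.
move=> mb [mf f0]; split=> [|x]; last by case: ifP.
by apply: measurable_fun_ifT => //; exact: measurable_cst.
Qed.

Lemma measurable_gt (f : T -> \bar R) (c : \bar R) : nnm f ->
  measurable_fun setT (fun x => c < f x).
Proof. by move=> [mf _]; apply: measurable_fun_lte => //; exact: measurable_cst. Qed.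

Lemma measurable_le (f : T -> \bar R) (c : \bar R) : nnm f ->
  measurable_fun setT (fun x => f x <= c).
Proof.
move=> hf; rewrite (_ : (fun x => _) = (fun x => ~~ (c < f x))); last first.
  by apply/funext => x; rewrite leNgt.
exact/measurable_neg/measurable_gt.
Qed.

Definition weight (w : T -> R) := measurable_fun setT w /\ forall x, (0 < w x)%R.

Lemma weight_nnm w : weight w -> nnm (fun x => (w x)%:E).
Proof. by move=> [mw w0]; apply: nnm_EFin => // x; exact: ltW. Qed.

Lemma weight_pow w (q : R) : weight w -> weight (fun x => w x `^ q)%R.
Proof.
move=> [mw w0]; split=> [|x]; last exact: powR_gt0.
exact: (measurableT_comp (measurable_powR q)).
Qed.

Definition sumpow (r : R) (g : nat -> T -> \bar R) x := \sum_(k <oo) g k x `^ r.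

Lemma sumpow_nnm r (g : nat -> T -> \bar R) : (forall k, nnm (g k)) -> nnm (sumpow r g).
Proof. by move=> hg; apply: nnm_sum => k; exact: nnm_pow. Qed.

Definition lrnorm (r : R) (g : nat -> T -> \bar R) x := sumpow r g x `^ r^-1.

Lemma lrnorm_nnm r (g : nat -> T -> \bar R) : (forall k, nnm (g k)) -> nnm (lrnorm r g).
Proof. by move=> hg; apply: nnm_pow; exact: sumpow_nnm. Qed.

End nonneg_measurable.

(** * Integrals of nonnegative functions *)

Section integral_tools.
Context {d : measure_display} {T : measurableType d} {R : realType}.
Variable mu : {measure set T -> \bar R}.
Local Open Scope ereal_scope.

(* The integral of a nonnegative function is a supremum over simple functions,
   hence monotone without any measurability. *)
Lemma lower_integral_mono (f g : T -> \bar R) : (forall x, 0 <= f x) ->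
  (forall x, f x <= g x) -> \int[mu]_x f x <= \int[mu]_x g x.
Proof.
move=> f0 fg; rewrite !ge0_integralTE//; last by move=> x; rewrite (le_trans (f0 x)).
by apply: le_ereal_sup => _ [h hf <-]; exists h => // x; rewrite (le_trans (hf x)).
Qed.

Lemma nnm_le_int f g : nnm f -> nnm g -> {ae mu, forall x, f x <= g x} ->
  \int[mu]_x f x <= \int[mu]_x g x.
Proof.
move=> [mf f0] [mg g0] fg; apply: ae_ge0_le_integral => //.
by apply: filterS fg => x fgx _.
Qed.

Lemma integral_setE f (A : set T) : \int[mu]_(x in A) f x = \int[mu]_x ((\1_A x)%:E * f x).
Proof.
rewrite integral_mkcond; apply: eq_integral => x _.
rewrite patchE indicE; case: ifP => _; first by rewrite mul1e.
by rewrite mul0e.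
Qed.

Lemma nnm_int_scale (c : R) f : (0 <= c)%R -> nnm f ->
  \int[mu]_x (c%:E * f x) = c%:E * \int[mu]_x f x.
Proof. by move=> c0 [mf f0]; rewrite ge0_integralZl. Qed.

Lemma nnm_int_sum (f : nat -> T -> \bar R) : (forall k, nnm (f k)) ->
  \int[mu]_x (\sum_(k <oo) f k x) = \sum_(k <oo) \int[mu]_x f k x.
Proof.
move=> hf; apply: integral_nneseries => // k; first exact: (hf k).1.
by move=> x _; exact: (hf k).2.
Qed.

Lemma nnm_int_lty f : nnm f -> \int[mu]_x f x < +oo -> {ae mu, forall x, f x < +oo}.
Proof.
move=> [mf f0] fi.
have : mu.-integrable setT f.
  by apply/integrableP; split=> //; under eq_integral do rewrite gee0_abs//.
move/integrable_ae => /(_ measurableT).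
by apply: filterS => x /(_ Logic.I); rewrite ge0_fin_numE.
Qed.

End integral_tools.

(** * Weights given by a Musielak-Orlicz function *)

Section musielak_orlicz.
Context {d : measure_display} {T : measurableType d} {R : realType}.
Variable P : probability T R.
Local Open Scope ereal_scope.

Lemma MO_weight phi (t : R) : MO_function P phi -> (0 < t)%R -> weight (phi ^~ t).
Proof.
move=> [_ _ _ mphi hphi] t0; split; first by apply: mphi; exact: ltW.
by move=> x; have [] := hphi t t0.
Qed.

Lemma MO_int phi (t : R) : MO_function P phi -> (0 < t)%R ->
  \int[P]_x (phi x t)%:E < +oo.
Proof.
move=> hMO t0; have hw := weight_nnm (MO_weight hMO t0).
have [_ _ _ _ /(_ t t0)[_ /integrableP[_]]] := hMO.
by under eq_integral do rewrite gee0_abs ?hw.2//.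
Qed.

End musielak_orlicz.

(** * Young's inequality with constants *)

Section lossy_young.
Context {R : realType}.
Implicit Types (th s : R).

Lemma le_poweR (q : R) (x y : \bar R) : 0 <= q -> (0 <= x)%E -> (x <= y)%E ->
  (x `^ q <= y `^ q)%E.
Proof.
move=> q0 x0 xy; apply: gt0_ler_poweR; rewrite // in_itv/= leey andbT//.
exact: le_trans xy.
Qed.

Lemma lty_of_poweR_mul (q c : R) (x : \bar R) : 0 < q -> 0 < c -> (0 <= x)%E ->
  (x `^ q * c%:E < +oo)%E -> (x < +oo)%E.
Proof.
move=> q0 c0; case: x => [x _ _| |] //; first exact: ltry.
by rewrite poweRyr ?gt_eqF// gt0_mulye// lte_fin.
Qed.

Lemma powRD_gt0 (x q s : R) : 0 < x -> x `^ (q + s) = x `^ q * x `^ s.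
Proof. by move=> x0; rewrite powRD// (gt_eqF x0) implybT. Qed.

Lemma invr_powRN (c q : R) : 0 <= c -> c^-1 `^ (- q) = c `^ q.
Proof. by move=> c0; rewrite -[c^-1]powR_inv1// -powRrM mulN1r opprK. Qed.

Lemma powR_div_id (s : R) (q : R) : 0 < s -> s `^ q * s `^ (- q) = 1.
Proof. by move=> s0; rewrite powRN mulfV// gt_eqF// powR_gt0. Qed.

(** No convexity is involved: if b <= s a the first term alone dominates, otherwise the second one
    does. *)
Lemma lossy_young_real (a b s th : R) : 0 <= a -> 0 <= b -> 0 < s -> 0 < th < 1 ->
  a `^ th * b `^ (1 - th) <= s `^ (1 - th) * a + s `^ (- th) * b.
Proof.
move=> a0 b0 s0 /andP[th0 th1]; have t1 : 0 < 1 - th by rewrite subr_gt0.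
have split_pow (c : R) : 0 <= c -> c `^ th * c `^ (1 - th) = c.
  move=> c0; rewrite -powRD ?subrKC ?powRr1//.
  by rewrite oner_eq0.
have sa0 := mulr_ge0 (ltW s0) a0.
have [bsa|sab] := leP b (s * a).
  rewrite -[leLHS]addr0 lerD ?mulr_ge0 ?powR_ge0//.
  rewrite -[in leRHS](split_pow a a0) mulrCA ler_wpM2l ?powR_ge0//.
  rewrite -powRM ?(ltW s0)//.
  by rewrite ge0_ler_powR ?nnegrE ?(ltW t1).
rewrite -[leLHS]add0r lerD ?mulr_ge0 ?powR_ge0//.
rewrite -[in leRHS](split_pow b b0) mulrA ler_wpM2r ?powR_ge0//.
rewrite -[leLHS]mul1r -(powR_div_id th s0) mulrAC mulrC ler_wpM2l ?powR_ge0//.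
rewrite -powRM ?(ltW s0)//.
by rewrite ge0_ler_powR ?nnegrE ?(ltW th0) ?(ltW sab).
Qed.

Lemma lossy_young (a b : \bar R) s th : (0 <= a -> 0 <= b -> 0 < s%:E -> (0 < th < 1)%R ->
  a `^ th * b `^ (1 - th) <= (s `^ (1 - th))%:E * a + (s `^ (- th))%:E * b)%E.
Proof.
move=> a0 b0; rewrite lte_fin => s0 th01; have /andP[th0 th1] := th01.
have p1 q : (0 < (s `^ q)%:E)%E by rewrite lte_fin powR_gt0.
case: a a0 => [a| |] // a0.
- case: b b0 => [b| |] // b0; last by rewrite gt0_muley// addey ?leey//.
  by rewrite !poweR_EFin -!EFinM -EFinD lee_fin lossy_young_real// -lee_fin.
- rewrite gt0_muley// addye ?leey// gt_eqF//.
  by rewrite (@lt_le_trans _ _ 0%E) ?ltNy0// mule_ge0// ltW.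
Qed.

Lemma lossy_young_inv (X A B : \bar R) th : (0 < th < 1)%R -> (0 <= A)%E -> (0 <= B)%E ->
  (B < +oo)%E -> (A < +oo \/ 0 < B)%E ->
  (forall i, (X <= (dyad i `^ (1 - th))%:E * A + (dyad i `^ (- th))%:E * B)%E) ->
  (X <= 3%:E * (A `^ th * B `^ (1 - th)))%E.
Proof.
move=> /andP[th0 th1] + + + AB.
have t1 : 0 < 1 - th by rewrite subr_gt0.
case: B AB => [B| |] // AB; case: A AB => [A| |] // AB A0 B0 _; last first.
  case: AB => // B1 _.
  by rewrite poweRyr ?gt_eqF// gt0_mulye ?poweR_gt0// gt0_muley ?leey// lte_fin.
rewrite !lee_fin in A0 B0 => h.
have small (e : R) (q : R) : 0 < e -> 0 < q -> exists i, (dyad i : R) `^ q <= e.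
  move=> e0 q0; have [i /andP[hi _]] := dyad_between (powR_gt0 (q^-1) e0).
  exists i; rewrite (@le_trans _ _ ((e `^ q^-1) `^ q))//.
    by rewrite ge0_ler_powR ?nnegrE ?(ltW q0) ?powR_ge0 ?(ltW (dyad_gt0 _)) ?(ltW hi).
  by rewrite -powRrM mulVf ?gt_eqF// powRr1// ltW.
have large (e : R) (q : R) : 0 < e -> 0 < q -> exists i, (dyad i : R) `^ (- q) <= e.
  move=> e0 q0.
  have y0 : 0 < 2 * (e^-1 `^ q^-1) by rewrite mulr_gt0// powR_gt0// invr_gt0.
  have [i /andP[_ hi]] := dyad_between y0.
  rewrite ler_pM2l// in hi; exists i.
  rewrite powRN -[leRHS]invrK lef_pV2 ?posrE ?powR_gt0 ?invr_gt0 ?dyad_gt0//.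
  rewrite (@le_trans _ _ ((e^-1 `^ q^-1) `^ q))//.
    by rewrite -powRrM mulVf ?gt_eqF// powRr1// invr_ge0 ltW.
  by rewrite ge0_ler_powR ?nnegrE ?(ltW q0) ?powR_ge0 ?(ltW (dyad_gt0 _)).
have [A00|A00] := eqVneq A 0.
  rewrite A00 poweR_EFin powR0 ?gt_eqF// mul0e mule0.
  apply/lee_addgt0Pr => e e0; rewrite add0e.
  have [B00|B00] := eqVneq B 0.
    by apply: le_trans (h 0%N) _; rewrite A00 B00 !mule0 adde0 lee_fin ltW.
  have B1 : 0 < B by rewrite lt0r B00.
  have [i hi] := large (e / B) th (divr_gt0 e0 B1) th0.
  apply: le_trans (h i) _; rewrite A00 mule0 add0e -EFinM lee_fin.
  by rewrite -ler_pdivlMr.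
have A1 : 0 < A by rewrite lt0r A00.
have [B00|B00] := eqVneq B 0.
  rewrite B00 [(0%:E `^ (1 - th))%E]poweR_EFin powR0 ?gt_eqF// mule0 mule0.
  apply/lee_addgt0Pr => e e0; rewrite add0e.
  have [i hi] := small (e / A) (1 - th) (divr_gt0 e0 A1) t1.
  apply: le_trans (h i) _; rewrite B00 mule0 adde0 -EFinM lee_fin.
  by rewrite -ler_pdivlMr.
have B1 : 0 < B by rewrite lt0r B00.
have [i /andP[h1 h2]] := dyad_between (divr_gt0 B1 A1).
apply: le_trans (h i) _; rewrite !poweR_EFin -!EFinM -EFinD lee_fin.
have d0 : 0 < (dyad i : R) by exact: dyad_gt0.
have E1 : dyad i `^ (1 - th) * A <= A `^ th * B `^ (1 - th).
  rewrite (@le_trans _ _ ((B / A) `^ (1 - th) * A))//.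
    rewrite ler_wpM2r// ge0_ler_powR ?nnegrE ?(ltW t1) ?(ltW d0) ?(ltW h1)//.
    by rewrite divr_ge0.
  rewrite powRM ?invr_ge0// -mulrA mulrC ler_wpM2r ?powR_ge0//.
  rewrite -powR_inv1// -powRrM mulN1r opprB -[X in _ * X]powRr1//.
  by rewrite -powRD ?subrK// ?subrK ?gt_eqF ?implybT//.
have E2 : dyad i `^ (- th) * B <= 2 * (A `^ th * B `^ (1 - th)).
  rewrite (@le_trans _ _ ((B / A / 2) `^ (- th) * B))//.
    rewrite ler_wpM2r// !powRN lef_pV2 ?posrE ?powR_gt0 ?divr_gt0//.
    rewrite ge0_ler_powR ?nnegrE ?(ltW th0) ?(ltW d0) ?divr_ge0//.
    by rewrite ler_pdivrMr// [leRHS]mulrC.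
  rewrite !powRM ?invr_ge0 ?divr_ge0//.
  rewrite powRN -[in X in _ * X * _ * _](powR_inv1 A0) -[in X in _ * X * _](powR_inv1 (ler0n _ 2)).
  rewrite -!powRrM !mulN1r !opprK -[X in _ * X <= _]powRr1//.
  rewrite [leLHS](_ : _ = 2 `^ th * (A `^ th * (B `^ (- th) * B `^ 1))); last first.
    by rewrite powRN; ring.
  rewrite -powRD; last by rewrite B00 implybT.
  rewrite [- th + 1]addrC ler_wpM2r ?mulr_ge0 ?powR_ge0//.
  rewrite -[leRHS]powRr1// ler_powR ?ler1n// ltW//.
rewrite (le_trans (lerD E1 E2))//.
have : 0 <= A `^ th * B `^ (1 - th) by rewrite mulr_ge0// powR_ge0.
lra.
Qed.

(** The same threshold argument, comparing z with c u^(1/(s-1)). The free parameter c is what later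
    allows one term to be made small and absorbed. *)
Lemma young_scaled (z u c s : R) : 0 <= z -> 0 <= u -> 0 < c -> 1 < s ->
  z * u <= c * u `^ (s / (s - 1)) + c `^ (1 - s) * z `^ s.
Proof.
move=> z0 u0 c0 s1; have s10 : 0 < s - 1 by rewrite subr_gt0.
have s0 : 0 < s by exact: lt_trans s1.
have sE : s / (s - 1) = (s - 1)^-1 + 1 by field; rewrite gt_eqF.
have q0 : 0 < (s - 1)^-1 by rewrite invr_gt0.
have uE : u `^ (s / (s - 1)) = u `^ (s - 1)^-1 * u.
  rewrite sE powRD ?powRr1//; apply/implyP => /eqP h.
  by have := addr_gt0 q0 (@ltr01 R); rewrite h ltxx.
have [h|h] := leP z (c * u `^ (s - 1)^-1).
  rewrite -[leLHS]addr0 lerD ?mulr_ge0 ?powR_ge0//.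
  by rewrite uE mulrA ler_wpM2r.
rewrite -[leLHS]add0r lerD//.
  by apply: mulr_ge0; [exact: ltW|exact: powR_ge0].
have zE : z `^ s = z * z `^ (s - 1) by rewrite mulr_powRB1.
have cE : c `^ (1 - s) = c^-1 `^ (s - 1).
  by rewrite -[c^-1]powR_inv1 ?(ltW c0)// -powRrM mulN1r opprB.
rewrite zE mulrCA ler_wpM2l// cE -powRM ?invr_ge0 ?(ltW c0)//.
have -> : u = (u `^ (s - 1)^-1) `^ (s - 1) by rewrite -powRrM mulVf ?powRr1// gt_eqF.
rewrite ge0_ler_powR ?nnegrE ?powR_ge0 ?(ltW s10)// ?mulr_ge0 ?invr_ge0 ?(ltW c0)//.
by rewrite ler_pdivlMl// ltW.
Qed.

End lossy_young.

(** * Interpolation *)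

Section interpolation.
Context {d : measure_display} {T : measurableType d} {R : realType}.
Variable mu : {measure set T -> \bar R}.
Local Open Scope ereal_scope.

Lemma integral_if (b : T -> bool) (f : T -> \bar R) :
  \int[mu]_(x in [set x | b x]) f x = \int[mu]_x (if b x then f x else 0).
Proof.
rewrite integral_mkcond; apply: eq_integral => x _; rewrite patchE.
by case: (boolP (b x)) => bx; [rewrite mem_set|rewrite memNset//; exact/negP].
Qed.

(* Marcinkiewicz interpolation with psi x t in place of the power t^p.  Since
   psi x (y x) need not be measurable in x, it is bounded through a measurable m. *)
Lemma interpolation (a b p0 p1 A C1 C2 : R) :
  (p0 < a)%R -> (b < p1)%R -> (0 < p1)%R -> (0 <= A)%R -> (0 < C1)%R -> (0 < C2)%R ->
  exists C : R, (0 < C)%R /\ forall (psi : T -> R -> R) (y z : T -> \bar R),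
    (forall x, psi x 0 = 0)%R -> (forall x t, (0 < t)%R -> (0 <= psi x t)%R) ->
    (forall x s t, (0 <= s)%R -> (s <= t)%R -> (psi x s <= psi x t)%R) ->
    (forall t, (0 < t)%R -> measurable_fun setT (psi ^~ t)) ->
    (forall x M, exists t : R, (0 < t)%R /\ (M <= psi x t)%R) ->
    (forall x t s, (0 <= t)%R -> (0 < s < 1)%R -> (psi x (s * t) <= C1 * s `^ a * psi x t)%R) ->
    (forall x t s, (0 <= t)%R -> (1 <= s)%R -> (psi x (s * t) <= C2 * s `^ b * psi x t)%R) ->
    nnm y -> nnm z ->
    (forall t : R, (0 < t)%R ->
      \int[mu]_x (if t%:E < y x then (psi x t)%:E else 0) <=
      (A * t `^ (- p0))%:E * \int[mu]_x (if t%:E < z x then z x `^ p0 * (psi x t)%:E else 0) +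
      (A * t `^ (- p1))%:E * \int[mu]_x (if z x <= t%:E then z x `^ p1 * (psi x t)%:E else 0)) ->
    exists m, [/\ nnm m, forall x, phi_ext psi x (y x) <= m x &
      \int[mu]_x m x <= C%:E * \int[mu]_x phi_ext psi x (z x)].
Proof.
move=> pa bp p10 A0 C10 C20.
pose K1 := ((1 - (2 `^ (a - p0))^-1)^-1 : R)%R.
pose K2 := ((1 - (2 `^ (p1 - b))^-1)^-1 : R)%R.
have Kpos (s : R) : (0 < s -> 0 <= (1 - (2 `^ s)^-1)^-1 :> R)%R.
  move=> s0; rewrite invr_ge0 subr_ge0 invf_le1 ?powR_gt0//.
  by have := @ler_powR R 2 (ler1n _ 2) 0%R s (ltW s0); rewrite powRr0.
have K10 : (0 <= K1)%R by apply: Kpos; rewrite subr_gt0.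
have K20 : (0 <= K2)%R by apply: Kpos; rewrite subr_gt0.
(* [C0] is the cost, by the upper type, of replacing a value by the power of 2 just below it. The
   [+ 1] in [C'] only makes that constant invertible. *)
pose C0 := (C2 * 2 `^ b)%R; have C00 : (0 < C0)%R by rewrite mulr_gt0// powR_gt0.
pose C' := (A * (C1 * K1 + C2 * K2) + 1)%R.
have C'0 : (0 < C')%R.
  by rewrite ltr_wpDl// mulr_ge0// addr_ge0// mulr_ge0// ltW.
exists (C0 * C')%R; split; first exact: mulr_gt0.
move=> psi y z psi0 psi_ge0 psi_mono mpsi psi_oo lo up hy hz H.
have d0 i : (0 < dyad i :> R)%R by exact: dyad_gt0.
have hpsi i : nnm (fun x => (psi x (dyad i))%:E).
  by apply: nnm_EFin => [|x]; [exact: mpsi|exact: psi_ge0].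
pose u i x := if (dyad i)%:E < y x then (psi x (dyad i))%:E else 0.
have hu i : nnm (u i) by apply: nnm_if => //; exact: measurable_gt.
pose v0 i x := if (dyad i)%:E < z x then z x `^ p0 * (psi x (dyad i))%:E else 0.
pose v1 i x := if z x <= (dyad i)%:E then z x `^ p1 * (psi x (dyad i))%:E else 0.
have hv0 i : nnm (v0 i).
  by apply: nnm_if; [exact: measurable_gt|apply: nnmM => //; exact: nnm_pow].
have hv1 i : nnm (v1 i).
  by apply: nnm_if; [exact: measurable_le|apply: nnmM => //; exact: nnm_pow].
pose w0 i x := (A * dyad i `^ (- p0))%:E * v0 i x.
pose w1 i x := (A * dyad i `^ (- p1))%:E * v1 i x.
have c0 i (q : R) : (0 <= A * dyad i `^ q)%R by rewrite mulr_ge0// powR_ge0.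
have hw0 i : nnm (w0 i) by apply: nnmM => //; apply: nnm_cst; rewrite lee_fin.
have hw1 i : nnm (w1 i) by apply: nnmM => //; apply: nnm_cst; rewrite lee_fin.
pose M x := \sum_(i <oo) (w0 i x + w1 i x).
have hM : nnm M by apply: nnm_sum => i; exact: nnmD.
(* The single summand with 2^i < y <= 2 * 2^i already gives the majorant. Where y is infinite every
   level contributes, and the sum diverges because psi is unbounded. *)
exists (fun x => C0%:E * \sum_(i <oo) u i x); split.
- by apply: nnmM; [apply: nnm_cst; rewrite lee_fin ltW|exact: nnm_sum].
- move=> x; have [+ y0] := hy; move=> _; have := y0 x.
  have un i : 0 <= u i x by exact: (hu i).2.
  have uge i : u i x <= \sum_(j <oo) u j x.
    apply: le_trans (@nneseries_lim_ge _ (u^~ x) xpredT 0%N i.+1 _) => //.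
    by rewrite big_nat_recr//= leeDr// sume_ge0.
  case yE : (y x) => [r| |] //=.
  + rewrite lee_fin => r0; rewrite ger0_norm//.
    have [->|r1] := eqVneq r 0%R.
      by rewrite psi0 mule_ge0 ?lee_fin ?(ltW C00)// nneseries_ge0.
    have r2 : (0 < r)%R by rewrite lt0r r1.
    have [i /andP[i1 i2]] := dyad_between r2.
    apply: le_trans (_ : C0%:E * u i x <= _); last first.
      by rewrite lee_wpmul2l ?lee_fin ?(ltW C00).
    rewrite /u yE lte_fin i1 -EFinM lee_fin (le_trans (psi_mono x r _ r0 i2))//.
    by rewrite up// ?ler1n// ltW.
  + move=> _; rewrite (_ : \sum_(i <oo) u i x = +oo) ?gt0_muley ?lte_fin//.
    apply/eqyP => N N0.
    have [t [t0 Nt]] := psi_oo x (C0 * N)%R.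
    have [i /andP[i1 i2]] := dyad_between t0.
    apply: le_trans (uge i); rewrite /u yE ltry lee_fin -(ler_pM2l C00).
    by rewrite (le_trans Nt)// (le_trans (psi_mono x t _ (ltW t0) i2))// up// ?ler1n// ltW.
rewrite nnm_int_scale ?(ltW C00)//; last exact: nnm_sum.
rewrite [(C0 * C')%:E]EFinM -[leRHS]muleA; apply: lee_wpmul2l.
  by rewrite lee_fin ltW.
apply: le_trans (_ : \int[mu]_x M x <= _).
  rewrite nnm_int_sum// nnm_int_sum; last by move=> i; exact: nnmD.
  apply: lee_nneseries => [i _ _|i _]; first by apply: integral_ge0 => x _; exact: (hu i).2.
  rewrite ge0_integralD//; [|by move=> x _; exact: (hw0 i).2|exact: (hw0 i).1
    |by move=> x _; exact: (hw1 i).2|exact: (hw1 i).1].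
  by rewrite !nnm_int_scale// H.
(* The constant is extracted on the side of the measurable M: the integrand on the right need not be
   measurable, and only monotonicity is available for it. *)
have -> : \int[mu]_x M x = C'%:E * \int[mu]_x ((C'^-1)%:E * M x).
  rewrite nnm_int_scale ?invr_ge0 ?(ltW C'0)// muleA -EFinM mulfV ?mul1e//.
  by rewrite gt_eqF.
rewrite lee_wpmul2l ?lee_fin ?(ltW C'0)//; apply: lower_integral_mono => x.
  by rewrite mule_ge0 ?hM.2// lee_fin invr_ge0 ltW.
rewrite lee_pdivrMl//.
have := hz.2 x; case zE : (z x) => [r| |] //=; last by rewrite gt0_muley ?leey ?lte_fin.
rewrite lee_fin => r0; rewrite ger0_norm//.
have [rE|r1] := eqVneq r 0%R.
  rewrite /M eseries0 ?rE ?psi0 ?mule0// => i _ _.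
  rewrite /w0 /w1 /v0 /v1 zE rE ltNge lee_fin (ltW (d0 i))/= mule0 add0e.
  by rewrite powR0 ?mul0e ?mule0// gt_eqF.
have r2 : (0 < r)%R by rewrite lt0r r1.
have ps0 := psi_ge0 x r r2.
have dn0 i : (dyad i != 0 :> R)%R by rewrite gt_eqF.
(* Levels below z: the lower type at the ratio [dyad i / r] leaves the positive power a - p0 of the
   level, summable towards 0. In [b1] the upper type leaves the power -(p1 - b), summable towards
   infinity. *)
have b0 i : w0 i x <= (A * C1 * psi x r * r `^ (p0 - a))%:E *
    ((dyad i <= r)%R%:R * dyad i `^ (a - p0))%:E.
  rewrite /w0 /v0 zE lte_fin; case: ltP => ir; last first.
    by rewrite mule0 -EFinM lee_fin !mulr_ge0 ?powR_ge0// ltW.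
  rewrite (ltW ir) poweR_EFin -!EFinM lee_fin mul1r.
  have s01 : (0 < dyad i / r < 1)%R by rewrite divr_gt0// ltr_pdivrMr// mul1r.
  have := lo x r _ r0 s01; rewrite divfK// => hlo.
  rewrite -mulrA; apply: (@le_trans _ _ (A * (dyad i `^ (- p0) *
    (r `^ p0 * (C1 * (dyad i / r) `^ a * psi x r)))))%R.
    by rewrite -[leLHS]mulrA !ler_wpM2l ?powR_ge0.
  rewrite le_eqVlt; apply/orP; left; apply/eqP.
  rewrite powRM ?invr_ge0 ?(ltW (d0 i))// -(powR_inv1 r0) -powRrM mulN1r.
  rewrite !powRD ?r1 ?dn0 ?implybT//.
  by ring.
have b1 i : w1 i x <= (A * C2 * psi x r * r `^ (p1 - b))%:E *
    ((r <= dyad i)%R%:R * dyad i `^ (- (p1 - b)))%:E.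
  rewrite /w1 /v1 zE lee_fin; case: (leP r (dyad i)) => ir; last first.
    by rewrite mule0 -EFinM lee_fin !mulr_ge0 ?powR_ge0// ltW.
  rewrite poweR_EFin -!EFinM lee_fin mul1r.
  have s01 : (1 <= dyad i / r)%R by rewrite ler_pdivlMr// mul1r.
  have := up x r _ r0 s01; rewrite divfK// => hup.
  rewrite -mulrA; apply: (@le_trans _ _ (A * (dyad i `^ (- p1) *
    (r `^ p1 * (C2 * (dyad i / r) `^ b * psi x r)))))%R.
    by rewrite -[leLHS]mulrA !ler_wpM2l ?powR_ge0.
  rewrite le_eqVlt; apply/orP; left; apply/eqP.
  rewrite powRM ?invr_ge0 ?(ltW (d0 i))// -(powR_inv1 r0) -powRrM mulN1r opprB.
  rewrite !powRD ?r1 ?dn0 ?implybT//.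
  by ring.
rewrite /M nneseriesD; [|by move=> i _ _; exact: (hw0 i).2|by move=> i _ _; exact: (hw1 i).2].
apply: (@le_trans _ _ ((A * C1 * psi x r * r `^ (p0 - a))%:E * (K1 * r `^ (a - p0))%:E +
   (A * C2 * psi x r * r `^ (p1 - b))%:E * (K2 * r `^ (- (p1 - b)))%:E)).
  have nn (c1 c2 q : R) : (0 <= c1 -> 0 <= A * c1 * psi x r * r `^ q)%R.
    by move=> h; rewrite !mulr_ge0 ?powR_ge0.
  apply: leeD.
    apply: le_trans (lee_nneseries _ (fun i _ => b0 i)) _.
      by move=> i _ _; exact: (hw0 i).2.
    rewrite nneseriesZl; last by move=> i _; rewrite lee_fin mulr_ge0// powR_ge0.
    rewrite lee_wpmul2l ?lee_fin ?nn// ?(ltW C10)//.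
    by apply: dyad_sum_below; rewrite ?subr_gt0.
  apply: le_trans (lee_nneseries _ (fun i _ => b1 i)) _.
    by move=> i _ _; exact: (hw1 i).2.
  rewrite nneseriesZl; last by move=> i _; rewrite lee_fin mulr_ge0// powR_ge0.
  rewrite lee_wpmul2l ?lee_fin ?nn// ?(ltW C20)//.
  by apply: dyad_sum_above; rewrite ?subr_gt0.
rewrite -!EFinM -EFinD lee_fin.
have e1 : (r `^ (p0 - a) * r `^ (a - p0) = 1)%R.
  by rewrite -[(a - p0)%R]opprB powR_div_id.
have e2 := powR_div_id (p1 - b) r2.
rewrite [leLHS](_ : _ = (A * C1 * psi x r * K1 * (r `^ (p0 - a) * r `^ (a - p0)) +
   A * C2 * psi x r * K2 * (r `^ (p1 - b) * r `^ (- (p1 - b)))))%R; last by ring.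
rewrite e1 e2 !mulr1 /C'; nra.
Qed.

End interpolation.
Import HBNNSimple.

(** * Conditional expectations and weighted maximal inequalities *)

Section conditional_expectation.
Context {d : measure_display} {T : measurableType d} {R : realType}.
Variables (P : probability T R) (F : nat -> set (set T)).
Variable E : nat -> (T -> \bar R) -> T -> \bar R.
Hypotheses (hF : filtration F) (hE : cond_exp_family P F E).
Local Open Scope ereal_scope.
Implicit Types (f g X Y : T -> \bar R) (n : nat) (A : set T).

Definition Fnnm n X := sub_measurable (F n) X /\ forall x, 0 <= X x.

Let sF n : sigma_algebra setT (F n). Proof. by case: hF. Qed.
Lemma F_meas n A : F n A -> measurable A.
Proof. by case: hF => _ h _; exact: h. Qed.

Lemma F_setT n : F n setT.
Proof.
have := @measurableT _ (g_sigma_algebraType (F n)).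
by rewrite /measurable/= sigma_algebra_id.
Qed.

Lemma sub_measurableP n X : sub_measurable (F n) X <->
  measurable_fun setT (X : g_sigma_algebraType (F n) -> \bar R).
Proof.
have FE : <<s F n>> = F n by rewrite sigma_algebra_id.
split=> [h _ B mB|h B mB]; first by rewrite setTI /measurable/= FE; exact: h.
by have := h measurableT B mB; rewrite setTI /measurable/= FE.
Qed.

Lemma F_I n A B : F n A -> F n B -> F n (A `&` B).
Proof.
have FE : <<s F n>> = F n by rewrite sigma_algebra_id.
have := @measurableI _ (g_sigma_algebraType (F n)) A B.
by rewrite /measurable/= FE.
Qed.

Lemma F_lt n X Y : sub_measurable (F n) X -> sub_measurable (F n) Y ->
  F n [set x | X x < Y x].
Proof.
move=> /sub_measurableP mX /sub_measurableP mY.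
have FE : <<s F n>> = F n by rewrite sigma_algebra_id.
have := measurable_fun_lte mX mY measurableT (Y := [set true]) Logic.I.
by rewrite setTI /measurable/= FE; congr (F n _).
Qed.

Lemma Fnnm_nnm n X : Fnnm n X -> nnm X.
Proof.
move=> [mX X0]; split=> // _ B mB; rewrite setTI.
exact/F_meas/mX.
Qed.

Lemma FnnmM n X Y : Fnnm n X -> Fnnm n Y -> Fnnm n (fun x => X x * Y x).
Proof.
move=> [/sub_measurableP mX X0] [/sub_measurableP mY Y0]; split=> [|x].
  by apply/sub_measurableP; exact: emeasurable_funM.
by rewrite mule_ge0.
Qed.

Lemma FnnmD n X Y : Fnnm n X -> Fnnm n Y -> Fnnm n (fun x => X x + Y x).
Proof.
move=> [/sub_measurableP mX X0] [/sub_measurableP mY Y0]; split=> [|x].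
  by apply/sub_measurableP; exact: emeasurable_funD.
by rewrite adde_ge0.
Qed.

Lemma Fnnm_cst n (c : \bar R) : 0 <= c -> Fnnm n (fun=> c).
Proof. by move=> c0; split=> //; apply/sub_measurableP; exact: measurable_cst. Qed.

Lemma Fnnm_comp n X (h : \bar R -> \bar R) : measurable_fun setT h ->
  (forall y, 0 <= h y) -> Fnnm n X -> Fnnm n (fun x => h (X x)).
Proof.
move=> mh h0 [/sub_measurableP mX X0]; split=> [|x]; last exact: h0.
by apply/sub_measurableP; exact: (measurableT_comp mh).
Qed.

Lemma Fnnm_indic n A : F n A -> Fnnm n (fun x => (\1_A x)%:E).
Proof.
move=> FA; split=> [|x]; last by rewrite lee_fin indicE ler0n.
apply/sub_measurableP/measurable_EFinP/measurable_indic.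
by rewrite /measurable/= sigma_algebra_id.
Qed.

(** The test set {Y < X} is cut by Y < m, so that the integral of Y over it is finite and can be
    subtracted even though both functions may take the value +oo. Monotonicity, subadditivity and
    the pull-out rule for [E] all come from this comparison. *)
Lemma ae_le_of_integral n X Y : Fnnm n X -> Fnnm n Y ->
  (forall A, F n A -> \int[P]_(x in A) X x <= \int[P]_(x in A) Y x) ->
  {ae P, forall x, X x <= Y x}.
Proof.
move=> hX hY h.
have [mX X0] := Fnnm_nnm hX; have [mY Y0] := Fnnm_nnm hY.
have key m : {ae P, forall x, ~ (Y x < X x /\ Y x < m%:R%:E)}.
  pose A := [set x | Y x < X x] `&` [set x | Y x < m%:R%:E].
  have FA : F n A.
    by apply: F_I; apply: F_lt; rewrite ?hX.1 ?hY.1 //; [exact: hY.1|exact: hX.1|exact: hY.1|exact: (Fnnm_cst n (lee0n m)).1].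
  have mA := F_meas FA.
  pose D x := X x - Y x.
  have mD : measurable_fun A D.
    by apply: emeasurable_funB; apply: measurable_funTS.
  have Yfin x : A x -> Y x \is a fin_num.
    by move=> [_ /= Ym]; rewrite ge0_fin_numE// (lt_trans Ym)// ltry.
  have D0 x : A x -> 0 < D x.
    by move=> Ax; rewrite /D sube_gt0 //; case: Ax.
  have IY : \int[P]_(x in A) Y x < +oo.
    apply: (@le_lt_trans _ _ (\int[P]_(x in A) (cst m%:R%:E) x)).
      apply: ge0_le_integral => //; first exact: measurable_funTS.
      by move=> x [_ /= /ltW].
    by rewrite integral_cst// (le_lt_trans (lee_pmul _ _ (lexx _) (probability_le1 P mA)))// mule1 ltry.
  have IX : \int[P]_(x in A) X x = \int[P]_(x in A) D x + \int[P]_(x in A) Y x.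
    rewrite -ge0_integralD//; last 2 first.
    - by move=> x /D0/ltW.
    - exact: measurable_funTS.
    by apply: eq_integral => x /set_mem Ax; rewrite /D subeK// Yfin.
  have ID : \int[P]_(x in A) D x = 0.
    apply/eqP; rewrite eq_le integral_ge0 ?andbT; last by move=> x /D0/ltW.
    have := h A FA; rewrite IX; set a := \int[P]_(x in A) D x.
    by rewrite -leeBrDr ?subee// ge0_fin_numE// integral_ge0.
  have : ae_eq P A D (cst 0).
    apply/(ae_eq_integral_abs P mA mD); rewrite -[RHS]ID; apply: eq_integral => x /set_mem Ax.
    by rewrite gee0_abs// ltW// D0.
  apply: filterS => x Dx Ax; have := D0 x Ax; rewrite Dx //; by rewrite ltxx.
have /= := ae_foralln key; apply: filterS => x hx.
rewrite leNgt; apply/negP => YX.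
have Yf : Y x \is a fin_num by rewrite ge0_fin_numE// (lt_le_trans YX)// leey.
apply: (hx (Num.truncn (fine (Y x))).+1); split=> //.
by rewrite -[ltLHS]fineK// lte_fin truncnS_gt.
Qed.

Lemma condE_Fnnm n f : nnm f -> Fnnm n (E n f).
Proof. by move=> [mf f0]; have [h1 h2 _] := hE n mf f0. Qed.

Lemma condE_nnm n f : nnm f -> nnm (E n f).
Proof. by move=> /(condE_Fnnm n)/Fnnm_nnm. Qed.

Lemma condE_int n f A : nnm f -> F n A ->
  \int[P]_(x in A) E n f x = \int[P]_(x in A) f x.
Proof. by move=> [mf f0] FA; have [_ _] := hE n mf f0; apply. Qed.

Lemma condE_intT n f : nnm f -> \int[P]_x E n f x = \int[P]_x f x.
Proof. by move=> hf; apply: condE_int => //; exact: F_setT. Qed.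

Lemma nnm_le_int_set f g A : measurable A -> nnm f -> nnm g ->
  {ae P, forall x, A x -> f x <= g x} -> \int[P]_(x in A) f x <= \int[P]_(x in A) g x.
Proof.
by move=> mA [mf f0] [mg g0] fg; apply: ae_ge0_le_integral => //; exact: measurable_funTS.
Qed.

Lemma condE_mono n f g : nnm f -> nnm g -> {ae P, forall x, f x <= g x} ->
  {ae P, forall x, E n f x <= E n g x}.
Proof.
move=> hf hg fg; apply: (@ae_le_of_integral n); [exact: condE_Fnnm..|move=> A FA].
rewrite !condE_int//; apply: nnm_le_int_set => //; first exact: F_meas FA.
by apply: filterS fg => x fgx _.
Qed.

Lemma condE_add n f g : nnm f -> nnm g ->
  {ae P, forall x, E n (fun y => f y + g y) x <= E n f x + E n g x}.
Proof.
move=> hf hg; have hfg := nnmD hf hg.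
apply: (@ae_le_of_integral n); [exact: condE_Fnnm|by apply: FnnmD; exact: condE_Fnnm|move=> A FA].
have mA := F_meas FA.
rewrite condE_int//.
rewrite ge0_integralD//; [|by move=> x _; exact: hf.2|exact/measurable_funTS/hf.1
  |by move=> x _; exact: hg.2|exact/measurable_funTS/hg.1].
have [mEf Ef0] := condE_nnm n hf; have [mEg Eg0] := condE_nnm n hg.
rewrite ge0_integralD//; [|exact/measurable_funTS|exact/measurable_funTS].
by rewrite !condE_int.
Qed.

Lemma condE_id n X : Fnnm n X -> {ae P, forall x, E n X x = X x}.
Proof.
move=> hX; have hX' := Fnnm_nnm hX.
have h1 : {ae P, forall x, E n X x <= X x}.
  by apply: (@ae_le_of_integral n) => // [|A FA]; [exact: condE_Fnnm|rewrite condE_int].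
have h2 : {ae P, forall x, X x <= E n X x}.
  by apply: (@ae_le_of_integral n) => // [|A FA]; [exact: condE_Fnnm|rewrite condE_int].
by apply: filterS2 h1 h2 => x a b; apply/eqP; rewrite eq_le a.
Qed.

(** No integrability is assumed. X is approximated by simple functions for the sigma-algebra F n
    itself, so that their level sets are admissible test sets for E n f; monotone convergence does
    the rest. *)
Lemma pull_out_int n X f : Fnnm n X -> nnm f ->
  \int[P]_x (X x * f x) = \int[P]_x (X x * E n f x).
Proof.
move=> hX hf; have hEf := condE_nnm n hf.
have [/sub_measurableP mX X0] := hX.
pose T' := g_sigma_algebraType (F n).
pose gg := nnsfun_approx (@measurableT _ T') mX.
have Fpre m (y : R) : F n (gg m @^-1` [set y]).
  have := @measurable_funPTI _ _ T' R (gg m) _ (measurable_set1 y).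
  by rewrite /measurable/= sigma_algebra_id.
have g0 m (x : T) : (0 <= gg m x)%R by exact: fun_ge0.
have mg m : measurable_fun setT (gg m : T -> R).
  have mgm : measurable_fun setT (gg m : T' -> R) by [].
  move=> _ B mB; rewrite setTI; apply: (@F_meas n).
  have := mgm measurableT B mB.
  by rewrite setTI /measurable/= sigma_algebra_id.
have nd (x : T) : nondecreasing_seq (fun m => (gg m x)%:E).
  move=> a b ab; rewrite lee_fin.
  by have /lefP := @nd_nnsfun_approx _ T' R setT measurableT X mX a b ab; apply.
have cX (x : T) : (gg m x)%:E @[m --> \oo] --> X x.
  exact: (@cvg_nnsfun_approx _ T' R setT measurableT X mX (fun x _ => X0 x) x Logic.I).
have gX m (x : T) : (gg m x)%:E <= X x.
  have /(cvg_unique _ (cX x)) -> // := ereal_nondecreasing_cvgn (nd x).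
  by apply: ereal_sup_ubound; exists m.
have key (h : T -> \bar R) : nnm h ->
    \int[P]_x (X x * h x) = limn (fun m => \int[P]_x ((gg m x)%:E * h x)).
  move=> hh.
  rewrite -monotone_convergence//; last 3 first.
  - move=> m; apply: emeasurable_funM; last exact: hh.1.
    exact/measurable_EFinP.
  - by move=> m x _; rewrite mule_ge0 ?hh.2// lee_fin.
  - by move=> x _ a b ab; apply: lee_wpmul2r; [exact: hh.2|exact: nd].
  apply: eq_integral => x _; apply/esym/cvg_lim => //.
  (* The limit of a product is taken factorwise except in the form 0 * +oo; a zero factor makes the
     whole sequence 0. *)
  have [X00|X00] := eqVneq (X x) 0.
    rewrite X00 mul0e (_ : (fun m => _) = cst 0); first exact: cvg_cst.
    apply/funext => m; rewrite (_ : (gg m x)%:E = 0) ?mul0e//.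
    by apply/le_anti/andP; split; [rewrite -X00|rewrite lee_fin].
  have [h00|h00] := eqVneq (h x) 0.
    by rewrite h00 mule0 (_ : (fun m => _) = cst 0); [exact: cvg_cst|apply/funext => m; rewrite mule0].
  apply: cvgeM; [|exact: cX|exact: cvg_cst].
  by apply: neq0_mule_def; rewrite mule_eq0 negb_or X00.
have simple m (h : T -> \bar R) : nnm h -> \int[P]_x ((gg m x)%:E * h x) =
    \sum_(y \in range (gg m)) (y%:E * \int[P]_(x in gg m @^-1` [set y]) h x).
  move=> hh.
  have ind0 (y : R) (x : T) : 0 <= (y * \1_(gg m @^-1` [set y]) x)%:E.
    rewrite lee_fin indicE; case: (boolP (x \in _)) => [/set_mem <-|_].
      by rewrite mulr1.
    by rewrite mulr0.
  under eq_integral => x _.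
    rewrite fimfunE -fsumEFin// ge0_mule_fsuml//; over.
  rewrite ge0_integral_fsum//; last 2 first.
  - move=> y; apply: emeasurable_funM; last exact: hh.1.
    apply/measurable_EFinP/measurable_funM => //.
    exact/measurable_indic/F_meas/Fpre.
  - by move=> y x _; rewrite mule_ge0// hh.2.
  apply: eq_fsbigr => y /set_mem [x _ <-].
  rewrite [in RHS]integral_setE -nnm_int_scale//; last first.
    by apply: nnmM => //; apply: nnm_indic; exact/F_meas/Fpre.
  by apply: eq_integral => z _; rewrite muleA EFinM.
rewrite !key//; congr (limn _); apply/funext => m.
rewrite !simple//; apply: eq_fsbigr => y _.
by rewrite condE_int.
Qed.

Lemma pull_out n X f : Fnnm n X -> nnm f ->
  {ae P, forall x, E n (fun y => X y * f y) x = X x * E n f x}.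
Proof.
move=> hX hf; have hX' := Fnnm_nnm hX; have hXf := nnmM hX' hf.
have hXE : Fnnm n (fun x => X x * E n f x) by apply: FnnmM => //; exact: condE_Fnnm.
have key A : F n A -> \int[P]_(x in A) E n (fun y => X y * f y) x =
    \int[P]_(x in A) (X x * E n f x).
  move=> FA; rewrite condE_int// integral_setE [RHS]integral_setE.
  under eq_integral do rewrite muleA.
  rewrite (@pull_out_int n (fun x => (\1_A x)%:E * X x))//; last first.
    by apply: FnnmM => //; exact: Fnnm_indic.
  by apply: eq_integral => x _; rewrite muleA.
have h1 : {ae P, forall x, E n (fun y => X y * f y) x <= X x * E n f x}.
  by apply: (@ae_le_of_integral n) => // [|A FA]; [exact: condE_Fnnm|rewrite key].
have h2 : {ae P, forall x, X x * E n f x <= E n (fun y => X y * f y) x}.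
  by apply: (@ae_le_of_integral n) => // [|A FA]; [exact: condE_Fnnm|rewrite key].
by apply: filterS2 h1 h2 => x a b; apply/eqP; rewrite eq_le a.
Qed.

Lemma condE_scale n (c : R) f : (0 <= c)%R -> nnm f ->
  {ae P, forall x, E n (fun y => c%:E * f y) x = c%:E * E n f x}.
Proof.
by move=> c0 hf; apply: (@pull_out n (fun=> c%:E)) => //; apply: Fnnm_cst; rewrite lee_fin.
Qed.

Lemma condE_lty n f : nnm f -> \int[P]_x f x < +oo -> {ae P, forall x, E n f x < +oo}.
Proof.
by move=> hf fi; apply: nnm_int_lty; [exact: condE_nnm|rewrite condE_intT].
Qed.

(** The set where E n f vanishes belongs to F n, so f has integral 0 over it; f being positive, the
    set is null. *)
Lemma condE_gt0 n f : nnm f -> (forall x, 0 < f x) -> {ae P, forall x, 0 < E n f x}.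
Proof.
move=> hf f0; have hE' := condE_Fnnm n hf; have [mE E0] := condE_nnm n hf.
pose A := ~` [set x | 0 < E n f x].
have FA : F n A.
  have := F_lt (Fnnm_cst n (lexx 0)).1 hE'.1.
  have FE : <<s F n>> = F n by rewrite sigma_algebra_id.
  have := @measurableC _ (g_sigma_algebraType (F n)) [set x | 0 < E n f x].
  by rewrite /measurable/= FE; apply.
have mA := F_meas FA.
have : \int[P]_(x in A) `|f x| = 0.
  under eq_integral do rewrite gee0_abs ?hf.2//.
  rewrite -(condE_int hf FA); apply: integral0_eq => x /negP.
  by rewrite -leNgt => ?; apply/eqP; rewrite eq_le E0 andbT.
move/(ae_eq_integral_abs P mA (measurable_funTS hf.1)); apply: filterS => x fx.
rewrite ltNge; apply/negP => Ex.
have := fx _; rewrite /A/= => h; have := f0 x; rewrite h ?ltxx//.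
by apply/negP; rewrite -leNgt.
Qed.

(* The pointwise Young inequality is used for the countably many parameters
   [dyad i] only, hence the constant 3. *)
Lemma condE_holder n (th : R) f g : (0 < th < 1)%R -> nnm f -> nnm g ->
  {ae P, forall x, E n g x < +oo /\ (E n f x < +oo \/ 0 < E n g x)} ->
  {ae P, forall x, E n (fun y => f y `^ th * g y `^ (1 - th)) x <=
    3%:E * (E n f x `^ th * E n g x `^ (1 - th))}.
Proof.
move=> th01 hf hg hfin.
have hfg : nnm (fun y => f y `^ th * g y `^ (1 - th)) by apply: nnmM; exact: nnm_pow.
have p0 i q : 0 <= (dyad i `^ q)%:E :> \bar R by rewrite lee_fin powR_ge0.
have key i : {ae P, forall x, E n (fun y => f y `^ th * g y `^ (1 - th)) x <=
    (dyad i `^ (1 - th))%:E * E n f x + (dyad i `^ (- th))%:E * E n g x}.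
  have h1 : nnm (fun y => (dyad i `^ (1 - th))%:E * f y) by apply: nnmM => //; exact: nnm_cst.
  have h2 : nnm (fun y => (dyad i `^ (- th))%:E * g y) by apply: nnmM => //; exact: nnm_cst.
  have := condE_mono n hfg (nnmD h1 h2) (aeW _ (fun x => lossy_young (hf.2 x) (hg.2 x)
    (dyad_gt0 i : 0 < (dyad i)%:E) th01)).
  apply: filter_app; have := condE_add n h1 h2; apply: filter_app.
  have := condE_scale n (powR_ge0 (dyad i) (1 - th)) hf; apply: filter_app.
  have := condE_scale n (powR_ge0 (dyad i) (- th)) hg; apply: filter_app.
  by apply: aeW => x e1 e2 le1 le2; rewrite (le_trans le2)// (le_trans le1)// e1 e2.
have := ae_foralln key; apply: filter_app; move: hfin; apply: filter_app.
apply: aeW => x [gfin fin] hx; apply: lossy_young_inv => //.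
- exact: (condE_nnm n hf).2.
- exact: (condE_nnm n hg).2.
Qed.

(** * Maximal inequalities for the measures v dP *)

Lemma weight_condE_gt0 n w : weight w -> {ae P, forall x, 0 < E n (fun y => (w y)%:E) x}.
Proof. by move=> hw; apply: condE_gt0 => [|x]; [exact: weight_nnm|rewrite lte_fin hw.2]. Qed.

(* Junk value: [rinv] is 0 at 0 and at +oo. *)
Definition rinv (y : \bar R) : \bar R := (fine y `^ (-1))%:E.

Lemma Fnnm_pow n X (q : R) : Fnnm n X -> Fnnm n (fun x => X x `^ q).
Proof.
apply: (@Fnnm_comp n X (fun y => y `^ q)) => [|y]; last exact: poweR_ge0.
exact: measurable_poweR.
Qed.

Lemma Fnnm_rinv n X : Fnnm n X -> Fnnm n (fun x => rinv (X x)).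
Proof.
apply: (@Fnnm_comp n X rinv) => [|y]; last by rewrite lee_fin powR_ge0.
apply/measurable_EFinP; apply: (measurableT_comp (measurable_powR (-1))).
exact: fine_measurable.
Qed.

Lemma F_seqDU (B : nat -> set T) : (forall k, F k (B k)) -> forall k, F k (seqDU B k).
Proof.
move=> FB k; have FE : <<s F k>> = F k by rewrite sigma_algebra_id.
have FBk j : (j <= k)%N -> F k (B j) by move=> jk; case: hF => _ _ h; exact: (h j k jk).
have : @measurable _ (g_sigma_algebraType (F k)) (seqDU B k).
  rewrite /seqDU; apply: measurableD; first by rewrite /measurable/= FE.
  apply: bigsetU_measurable => j _; rewrite /measurable/= FE; apply: FBk.
  by rewrite ltnW.
by rewrite /measurable/= FE.
Qed.

(** By Bayes' formula this is the conditional expectation of h / v under the measure v dP, so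
    [maxratio] is the maximal function of h / v for that measure. Writing it as a ratio avoids a
    change of measure. *)
Definition condratio (v : T -> R) (h : T -> \bar R) k x :=
  E k h x * rinv (E k (fun y => (v y)%:E) x).
Definition maxratio v h x := ereal_sup (range (fun k => condratio v h k x)).

Lemma condratio_Fnnm v h k : weight v -> nnm h -> Fnnm k (condratio v h k).
Proof.
move=> hv hh; apply: FnnmM; first exact: condE_Fnnm.
by apply: Fnnm_rinv; apply: condE_Fnnm; exact: weight_nnm.
Qed.

Lemma maxratio_nnm v h : weight v -> nnm h -> nnm (maxratio v h).
Proof. by move=> hv hh; apply: nnm_sup => k; apply: Fnnm_nnm; exact: condratio_Fnnm. Qed.

Lemma maxratio_ge v h k x : condratio v h k x <= maxratio v h x.
Proof. by apply: ereal_sup_ubound; exists k. Qed.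

(** Doob's weak (1,1) bound for h / v under v dP. The part of h below t v / 2 accounts for at most
    half of the level t, so only the large values of h / v remain on the right, as interpolation
    requires; this is the origin of both factors 2. *)
Lemma doob_weak v h (t : R) : weight v -> nnm h -> (0 < t)%R ->
  (forall k, {ae P, forall x, E k (fun y => (v y)%:E) x < +oo}) ->
  \int[P]_x (if t%:E < maxratio v h x then (v x)%:E else 0) <=
  (2 / t)%:E * \int[P]_x (if t%:E < 2%:E * h x * ((v x)^-1)%:E then h x else 0).
Proof.
move=> hv hh t0 vfin; have hv' := weight_nnm hv.
have tt : (0 < 2 / t)%R by rewrite divr_gt0.
pose z x := 2%:E * h x * ((v x)^-1)%:E.
have hz : nnm z.
  apply: nnmM; first by apply: nnmM => //; apply: nnm_cst; rewrite lee_fin.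
  have := weight_nnm (weight_pow (-1) hv); congr nnm; apply/funext => x.
  by rewrite powR_inv1// ltW// hv.2.
pose h' x := if t%:E < z x then h x else 0.
have hh' : nnm h' by apply: nnm_if => //; exact: measurable_gt.
have hlow : nnm (fun x => (t / 2)%:E * (v x)%:E).
  by apply: nnmM => //; apply: nnm_cst; rewrite lee_fin divr_ge0// ltW.
have hsplit x : h x <= h' x + (t / 2)%:E * (v x)%:E.
  rewrite /h'; case: ltP => [_|]; first by rewrite leeDl// hlow.2.
  rewrite add0e /z lee_pdivrMr ?hv.2// => hz'.
  by rewrite -(@lee_pmul2l _ 2%:E)// muleA -EFinM [(2 * _)%R]mulrC divfK.
pose B k := [set x | t%:E < condratio v h k x].
have FB k : F k (B k).
  apply: F_lt; last exact: (condratio_Fnnm k hv hh).1.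
  by apply: (Fnnm_cst k (_ : 0 <= t%:E)).1; rewrite lee_fin ltW.
(* [A k] is the event that the ratio exceeds t for the first time at k. It lies in F k, so integrals
   over it may be taken of conditional expectations instead. *)
pose A := seqDU B.
have FA : forall k, F k (A k) by exact: F_seqDU.
have mA k : measurable (A k) by exact: (F_meas (FA k)).
have UA : [set x | t%:E < maxratio v h x] = \bigcup_k A k.
  rewrite -seqDU_bigcup_eq; apply/seteqP; split=> x /=.
    move=> tx; apply: contrapT => nB.
    have : maxratio v h x <= t%:E.
      apply: ge_ereal_sup => _ [k _ <-]; rewrite leNgt; apply/negP => tk.
      by apply: nB; exists k.
    by rewrite leNgt tx.
  by move=> [k _ Bk]; exact: (lt_le_trans Bk (maxratio_ge v h k x)).
rewrite -integral_if UA ge0_integral_bigcup//; last 3 first.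
- exact/measurable_funTS/hv'.1.
- by move=> x _; exact: hv'.2.
- exact: trivIset_seqDU.
apply: (@le_trans _ _ ((2 / t)%:E * \int[P]_(x in \bigcup_k A k) h' x)); last first.
  rewrite lee_wpmul2l ?lee_fin ?(ltW tt)//.
  apply: ge0_subset_integral => //; [exact: bigcup_measurable|exact: hh'.1|].
  by move=> x _; exact: hh'.2.
rewrite ge0_integral_bigcup//; last 3 first.
- exact/measurable_funTS/hh'.1.
- by move=> x _; exact: hh'.2.
- exact: trivIset_seqDU.
rewrite -nneseriesZl; last by move=> k _; apply: integral_ge0 => x _; exact: hh'.2.
apply: lee_nneseries => [k _ _|k _]; first by apply: integral_ge0 => x _; exact: hv'.2.
rewrite -(condE_int hv' (FA k)) -(condE_int hh' (FA k)).
have hE' := condE_nnm k hh'; have hEv := condE_nnm k hv'.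
rewrite -ge0_integralZl//; last 3 first.
- exact/measurable_funTS/hE'.1.
- by move=> x _; exact: hE'.2.
- by rewrite lee_fin ltW.
apply: nnm_le_int_set => //.
  by apply: nnmM => //; apply: nnm_cst; rewrite lee_fin ltW.
have := condE_mono k hh (nnmD hh' hlow) (aeW _ hsplit); apply: filter_app.
have := condE_add k hh' hlow; apply: filter_app.
have := condE_scale k (divr_ge0 (ltW t0) (ler0n R 2)) hv'; apply: filter_app.
have := vfin k; apply: filter_app; have := weight_condE_gt0 k hv; apply: filter_app.
apply: aeW => x v0 vy e1 le1 le2 Ax.
have := subset_seqDU Ax; rewrite /B/= /condratio /rinv.
have [e eE] : exists e : R, E k (fun y => (v y)%:E) x = e%:E.
  by exists (fine (E k (fun y => (v y)%:E) x)); rewrite fineK// ge0_fin_numE// ltW.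
rewrite e1 in le1; have := le_trans le2 le1.
rewrite eE /=; move: v0; rewrite eE lte_fin => e0.
rewrite powR_inv1 ?(ltW e0)// lte_pdivlMr// -EFinM => h1 h2.
have := lt_le_trans h2 h1; have := hE'.2 x.
case: (E k h' x) => [r| |] //; last by rewrite gt0_muley ?leey ?lte_fin.
move=> _; rewrite -!EFinM -EFinD lte_fin lee_fin => h3.
have h4 : (t * e / 2 < r)%R by move: h3; lra.
rewrite mulrAC ler_pdivlMr// mulrC (le_trans _ (ltW (_ : t * e < 2 * r)%R))//.
by move: h4; lra.
Qed.

Lemma phi_ext_weight_pow (v : T -> R) (s : R) x (y : \bar R) : weight v -> (0 < s)%R -> 0 <= y ->
  phi_ext (fun x t => v x * t `^ s)%R x y = y `^ s * (v x)%:E.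
Proof.
move=> hv s0; case: y => [r| |] //; first by rewrite lee_fin => r0; rewrite /= ger0_norm// muleC.
by move=> _; rewrite poweRyr ?gt_eqF// gt0_mulye// lte_fin hv.2.
Qed.

(* Interpolation with psi x t = v x * t^s. *)
Lemma doob_strong (s : R) : (1 < s)%R -> exists C : R, (0 < C)%R /\
  forall v h, weight v -> nnm h ->
  (forall k, {ae P, forall x, E k (fun y => (v y)%:E) x < +oo}) ->
  \int[P]_x (maxratio v h x `^ s * (v x)%:E) <=
  C%:E * \int[P]_x ((h x * ((v x)^-1)%:E) `^ s * (v x)%:E).
Proof.
move=> s1; have s0 : (0 < s)%R by exact: lt_trans s1.
have s11 : (s < s + 1)%R by rewrite ltrDl.
(* [doob_weak] supplies the term of exponent 1 alone. The exponent s + 1 is an arbitrary one above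
   s; its term is bounded below by 0. *)
have [C [C0 H]] := @interpolation _ _ _ P s s 1 (s + 1) 1 1 1 s1 s11
  (addr_gt0 s0 ltr01) ler01 ltr01 ltr01.
exists (C * 2 `^ s)%R; split; first by rewrite mulr_gt0// powR_gt0.
move=> v h hv hh vfin.
pose psi x t := (v x * t `^ s)%R.
have v0 x : (0 < v x)%R by exact: hv.2.
have hvi : nnm (fun x => ((v x)^-1)%:E).
  have := weight_nnm (weight_pow (-1) hv); congr nnm; apply/funext => x.
  by rewrite powR_inv1// ltW.
pose z x := 2%:E * h x * ((v x)^-1)%:E.
have hz : nnm z.
  by apply: nnmM => //; apply: nnmM => //; apply: nnm_cst; rewrite lee_fin.
have hD := maxratio_nnm hv hh.
have [] := H psi (maxratio v h) z => //.
- by move=> x; rewrite /psi powR0 ?mulr0// gt_eqF.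
- by move=> x t t0; rewrite mulr_ge0 ?powR_ge0// ltW.
- move=> x t u t0 tu; rewrite ler_wpM2l ?(ltW (v0 x))// ge0_ler_powR ?nnegrE ?(ltW s0)//.
  exact: le_trans tu.
- by move=> t t0; apply: measurable_funM; [exact: hv.1|exact: measurable_cst].
- move=> x M; exists ((`|M| / v x + 1) `^ s^-1)%R; split.
    by rewrite powR_gt0// ltr_wpDl// divr_ge0// ltW.
  rewrite /psi -powRrM mulVf ?gt_eqF// powRr1; last by rewrite addr_ge0// divr_ge0// ltW.
  rewrite mulrDr mulr1 mulrC divfK ?gt_eqF// (le_trans (ler_norm M))// lerDl ltW//.
- move=> x t u t0 /andP[u0 _]; rewrite /psi powRM ?(ltW u0)// mul1r.
  by rewrite mulrCA.
- move=> x t u t0 u1; have u0 := lt_le_trans ltr01 u1; rewrite /psi powRM ?(ltW u0)// mul1r.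
  by rewrite mulrCA.
- move=> t t0.
  have -> : \int[P]_x (if t%:E < maxratio v h x then (psi x t)%:E else 0) =
      (t `^ s)%:E * \int[P]_x (if t%:E < maxratio v h x then (v x)%:E else 0).
    rewrite -nnm_int_scale ?powR_ge0//; last first.
      by apply: nnm_if; [exact: measurable_gt|exact: weight_nnm].
    apply: eq_integral => x _; case: ifP => _; last by rewrite mule0.
    by rewrite -EFinM mulrC.
  apply: (@le_trans _ _ ((1 * t `^ (- 1))%:E *
      \int[P]_x (if t%:E < z x then z x `^ 1 * (psi x t)%:E else 0))); last first.
    rewrite leeDl// mule_ge0//; first by rewrite lee_fin mul1r powR_ge0.
    apply: integral_ge0 => x _; case: ifP => // _; rewrite mule_ge0 ?poweR_ge0//.
    by rewrite lee_fin mulr_ge0 ?powR_ge0// ltW.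
  have -> : \int[P]_x (if t%:E < z x then z x `^ 1 * (psi x t)%:E else 0) =
      (t `^ s * 2)%:E * \int[P]_x (if t%:E < z x then h x else 0).
    rewrite -nnm_int_scale ?mulr_ge0 ?powR_ge0//; last first.
      by apply: nnm_if => //; exact: measurable_gt.
    apply: eq_integral => x _; case: ifP => _; last by rewrite mule0.
    rewrite poweRe1 ?hz.2// /z /psi EFinM muleA -[X in X * _]muleA -EFinM.
    by rewrite mulVf ?gt_eqF// mule1 muleC muleA -EFinM.
  rewrite muleA -EFinM mul1r powR_inv1 ?(ltW t0)//.
  rewrite [(t^-1 * _)%R](_ : _ = t `^ s * (2 / t))%R; last by ring.
  rewrite EFinM -[leRHS]muleA; apply: lee_wpmul2l; first by rewrite lee_fin powR_ge0.
  exact: doob_weak.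
move=> m [hm mD mi].
apply: (@le_trans _ _ (\int[P]_x m x)).
  apply: nnm_le_int => //.
    by apply: nnmM; [exact: nnm_pow|exact: weight_nnm].
  by apply: aeW => x; rewrite -phi_ext_weight_pow// hD.2.
apply: (le_trans mi); rewrite EFinM -[leRHS]muleA; apply: lee_wpmul2l; first by rewrite lee_fin ltW.
rewrite -nnm_int_scale ?powR_ge0//; last first.
  by apply: nnmM; [apply: nnm_pow; exact: nnmM|exact: weight_nnm].
under eq_integral => x _ do rewrite phi_ext_weight_pow ?hz.2//.
rewrite le_eqVlt; apply/orP; left; apply/eqP; apply: eq_integral => x _.
have hv0 : 0 <= h x * ((v x)^-1)%:E by apply: mule_ge0; [exact: hh.2|exact: hvi.2].
have -> : z x = 2%:E * (h x * ((v x)^-1)%:E) by rewrite /z muleA.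
by rewrite poweRM ?lee_fin// poweR_EFin muleA.
Qed.

(** * A_p weights and the weighted Doob inequality *)

(* w and sg are dual weights satisfying the martingale A_p condition. *)
Definition Apair (p K : R) (w sg : T -> R) :=
  [/\ weight w, weight sg, forall x, sg x = (w x `^ (- (p - 1)^-1))%R &
   forall k, {ae P, forall x, [/\ E k (fun y => (w y)%:E) x < +oo,
     E k (fun y => (sg y)%:E) x < +oo &
     E k (fun y => (w y)%:E) x * E k (fun y => (sg y)%:E) x `^ (p - 1) <= K%:E]}].

Lemma Apair_fine p K w sg : (1 < p)%R -> Apair p K w sg ->
  forall k, {ae P, forall x, exists e s : R, [/\ (0 < e)%R, (0 < s)%R,
    E k (fun y => (w y)%:E) x = e%:E, E k (fun y => (sg y)%:E) x = s%:E &
    (e * s `^ (p - 1) <= K)%R]}.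
Proof.
move=> p1 [hw hs _ h] k; have := h k; apply: filter_app.
have := weight_condE_gt0 k hw; apply: filter_app.
have := weight_condE_gt0 k hs; apply: filter_app.
apply: aeW => x s0 w0 [wy sy hK].
exists (fine (E k (fun y => (w y)%:E) x)), (fine (E k (fun y => (sg y)%:E) x)).
have we : E k (fun y => (w y)%:E) x = (fine (E k (fun y => (w y)%:E) x))%:E.
  by rewrite fineK// ge0_fin_numE// ltW.
have se : E k (fun y => (sg y)%:E) x = (fine (E k (fun y => (sg y)%:E) x))%:E.
  by rewrite fineK// ge0_fin_numE// ltW.
split=> //; rewrite -?lte_fin -?we -?se//.
by rewrite -lee_fin EFinM -we -poweR_EFin -se.
Qed.

(** With p' = p / (p - 1) one has p' - 1 = 1 / (p - 1), so raising the A_p condition to this power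
    exchanges w and sg. *)
Lemma Apair_sym p K w sg : (1 < p)%R -> Apair p K w sg ->
  Apair (p / (p - 1)) (K `^ (p - 1)^-1) sg w.
Proof.
move=> p1 hA; have p0 : (p - 1 != 0)%R by rewrite gt_eqF// subr_gt0.
have q1 : (p / (p - 1) - 1 = (p - 1)^-1)%R by field.
have hf := Apair_fine p1 hA; case: hA => hw hs hsg _; split=> // [x|k].
  rewrite hsg -powRrM q1 invrK mulNr mulrN opprK mulVf// powRr1//.
  by rewrite ltW// hw.2.
have := hf k; apply: filter_app; apply: aeW => x [e [s [e0 s0 -> -> hK]]].
split; rewrite ?ltry// q1 poweR_EFin -EFinM lee_fin.
have p1' : (0 < (p - 1)^-1)%R by rewrite invr_gt0 subr_gt0.
have es0 : (0 <= e * s `^ (p - 1))%R by rewrite mulr_ge0 ?powR_ge0// ltW.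
have <- : ((e * s `^ (p - 1)) `^ (p - 1)^-1 = s * e `^ (p - 1)^-1)%R.
  by rewrite powRM ?powR_ge0 ?(ltW e0)// -powRrM mulfV// powRr1 ?(ltW s0)// mulrC.
by rewrite ge0_ler_powR ?nnegrE ?(ltW p1')// (le_trans es0).
Qed.

Definition maxE (f : T -> \bar R) x := ereal_sup (range (fun k => E k f x)).

Lemma maxE_nnm f : nnm f -> nnm (maxE f).
Proof. by move=> hf; apply: nnm_sup => k; exact: condE_nnm. Qed.

Lemma maxE_ge f k x : E k f x <= maxE f x.
Proof. by apply: ereal_sup_ubound; exists k. Qed.

(* Lerner's argument: (M f)^(p-1) is dominated by M_w ((M_sg (f / sg))^(p-1) / w),
   which reduces the weighted bound to two unweighted ones. *)
Lemma doob_weighted (p K : R) : (1 < p)%R -> (0 < K)%R -> exists C : R, (0 < C)%R /\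
  forall w sg f, Apair p K w sg -> nnm f ->
  \int[P]_x (maxE f x `^ p * (w x)%:E) <= C%:E * \int[P]_x (f x `^ p * (w x)%:E).
Proof.
move=> p1 K0; have p0 : (0 < p)%R by exact: lt_trans p1.
have p10 : (0 < p - 1)%R by rewrite subr_gt0.
pose q := (p / (p - 1))%R.
have q1 : (1 < q)%R by rewrite ltr_pdivlMr// mul1r ltrBlDr ltrDl.
have q0 : (0 < q)%R by exact: lt_trans q1.
have pq : ((p - 1) * q = p)%R by rewrite mulrC divfK// gt_eqF.
have [C1 [C10 H1]] := doob_strong p1.
have [C2 [C20 H2]] := doob_strong q1.
exists (K `^ q * C2 * C1)%R; split; first by rewrite !mulr_gt0// powR_gt0.
move=> w sg f hA hf; have hfin := Apair_fine p1 hA.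
have [hw hs hsg hae] := hA.
have hG := maxratio_nnm hs hf; set G := maxratio sg f in hG *.
have hGp := nnm_pow (p - 1) hG.
have hD := maxratio_nnm hw hGp; set D := maxratio w _ in hD *.
(* Write E_k f = X_k E_k sg with X_k = [condratio sg f k]. As X_k^(p-1) is F_k-measurable and at
   most G^(p-1), it is bounded by E_k(G^(p-1)); the A_p condition bounds (E_k sg)^(p-1) by K / E_k
   w. The product is K times a ratio dominated by D. *)
have key : {ae P, forall x, forall k, E k f x `^ (p - 1) <= K%:E * D x}.
  apply: ae_foralln => k.
  have hX := condratio_Fnnm k hs hf.
  have hXp := Fnnm_pow (p - 1) hX.
  have XG x : condratio sg f k x `^ (p - 1) <= G x `^ (p - 1).
    by apply: le_poweR; [exact: ltW|exact: hX.2|exact: maxratio_ge].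
  have := condE_mono k (Fnnm_nnm hXp) hGp (aeW _ XG); apply: filter_app; have := condE_id hXp; apply: filter_app.
  have := hfin k; apply: filter_app.
  apply: aeW => x [e [s [e0 s0 eE sE hK]]] idX leX; rewrite idX in leX.
  have fE : E k f x = condratio sg f k x * s%:E.
    rewrite /condratio /rinv sE /= powR_inv1 ?(ltW s0)// -muleA -EFinM mulVf ?mule1//.
    by rewrite gt_eqF.
  rewrite fE poweRM ?hX.2 ?lee_fin ?(ltW s0)// poweR_EFin.
  apply: (@le_trans _ _ (E k (fun y => G y `^ (p - 1)) x * (s `^ (p - 1))%:E)).
    by rewrite lee_wpmul2r// lee_fin powR_ge0.
  apply: (@le_trans _ _ (K%:E * condratio w (fun y => G y `^ (p - 1)) k x)); last first.
    by rewrite lee_wpmul2l ?lee_fin ?(ltW K0)//; exact: maxratio_ge.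
  rewrite /condratio /rinv eE /= powR_inv1 ?(ltW e0)// muleCA lee_wpmul2l//.
    exact: (condE_nnm k hGp).2.
  by rewrite -EFinM lee_fin ler_pdivlMr// mulrC.
have wi : nnm (fun x => ((w x)^-1)%:E).
  have := weight_nnm (weight_pow (-1) hw); congr nnm; apply/funext => x.
  by rewrite powR_inv1// ltW// hw.2.
have pw f' : nnm f' -> nnm (fun x => f' x * (w x)%:E).
  by move=> ?; apply: nnmM => //; exact: weight_nnm.
apply: (@le_trans _ _ (\int[P]_x ((K `^ q)%:E * (D x `^ q * (w x)%:E)))).
  apply: nnm_le_int.
  - by apply: pw; apply: nnm_pow; exact: maxE_nnm.
  - apply: nnmM; first by apply: nnm_cst; rewrite lee_fin powR_ge0.
    by apply: pw; exact: nnm_pow.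
  have := key; apply: filter_app; apply: aeW => x hx.
  rewrite muleA lee_wpmul2r ?lee_fin ?(ltW (hw.2 x))//.
  rewrite -poweR_EFin -poweRM ?hD.2 ?lee_fin ?(ltW K0)//.
  have KD0 : 0 <= K%:E * D x by rewrite mule_ge0 ?hD.2// lee_fin ltW.
  have M0 : 0 <= maxE f x by exact: (maxE_nnm hf).2.
  have : maxE f x <= (K%:E * D x) `^ (p - 1)^-1.
    apply: ge_ereal_sup => _ [k _ <-].
    have e0 := (condE_nnm k hf).2 x.
    have -> : E k f x = (E k f x `^ (p - 1)) `^ (p - 1)^-1.
      by rewrite -poweRrM mulfV ?poweRe1// gt_eqF.
    by apply: le_poweR; rewrite ?invr_ge0 ?(ltW p10) ?poweR_ge0.
  by move/(le_poweR (ltW p0) M0); rewrite -poweRrM [((p - 1)^-1 * p)%R]mulrC.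
rewrite nnm_int_scale ?powR_ge0//; last by apply: pw; exact: nnm_pow.
rewrite -[(_ * _ * _)%R]mulrA EFinM -muleA; apply: lee_wpmul2l.
  by rewrite lee_fin powR_ge0.
apply: le_trans (H2 w _ hw hGp (fun k => _)) _.
  by move=> k; have := hae k; apply: filter_app; apply: aeW => x [].
rewrite EFinM -muleA; apply: lee_wpmul2l; first by rewrite lee_fin ltW.
(* Since (p - 1) q = p and w^(1-q) = sg, the bound under w dP ends in L^p(sg), where the bound under
   sg dP takes over. The last step uses sg^(1-p) = w. *)
have -> : \int[P]_x ((G x `^ (p - 1) * ((w x)^-1)%:E) `^ q * (w x)%:E) =
    \int[P]_x (G x `^ p * (sg x)%:E).
  apply: eq_integral => x _; have w0 := hw.2 x.
  rewrite poweRM ?poweR_ge0 ?wi.2// -poweRrM pq -muleA; congr (_ * _).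
  rewrite poweR_EFin -EFinM hsg; congr EFin.
  rewrite -powR_inv1 ?(ltW w0)// -powRrM -[X in (_ * X)%R]powRr1 ?(ltW w0)//.
  rewrite -powRD_gt0//.
  by congr (_ `^ _)%R; rewrite /q; field; rewrite gt_eqF.
apply: le_trans (H1 sg _ hs hf (fun k => _)) _.
  by move=> k; have := hae k; apply: filter_app; apply: aeW => x [].
apply: lee_wpmul2l; first by rewrite lee_fin ltW.
rewrite le_eqVlt; apply/orP; left; apply/eqP; apply: eq_integral => x _.
have w0 := hw.2 x; have s0 := hs.2 x.
rewrite poweRM ?hf.2 ?lee_fin ?invr_ge0 ?(ltW s0)// -muleA; congr (_ * _).
rewrite poweR_EFin -EFinM; congr EFin.
rewrite -powR_inv1 ?(ltW s0)// -powRrM -[X in (_ * X)%R]powRr1 ?(ltW s0)//.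
rewrite -powRD_gt0//.
rewrite hsg -powRrM -[RHS]powRr1 ?(ltW w0)//.
by congr (_ `^ _)%R; field; rewrite gt_eqF.
Qed.

(** * Weak-type bounds for sequences *)

Lemma Apair_pow p K w sg (q : R) x : Apair p K w sg -> (sg x `^ q = w x `^ (- (q / (p - 1))))%R.
Proof. by move=> [_ _ -> _]; rewrite -powRrM mulNr mulrC. Qed.

(* With A the level set, e_k = E_k(1_A w) and H = sup_k e_k, the weight
   V = H^t w^(1-t), t = (p-r)/(p-1), satisfies
   (E_k g)^r e_k <= C E_k(g^r V), and H is controlled in L^(p')(sg). *)
Lemma weak_type_above (p r K : R) : (1 < r)%R -> (r < p)%R -> (0 < K)%R ->
  exists C : R, (0 < C)%R /\ forall w sg, Apair p K w sg ->
  \int[P]_x (w x)%:E < +oo -> forall (g : nat -> T -> \bar R) (lam : R),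
  (forall k, nnm (g k)) -> (0 < lam)%R ->
  \int[P]_x (if lam%:E < sumpow r (fun k => E k (g k)) x then (w x)%:E else 0) <=
  (C * lam `^ (- (p / r)))%:E * \int[P]_x (sumpow r g x `^ (p / r) * (w x)%:E).
Proof.
move=> r1 rp K0; have r0 : (0 < r)%R by exact: lt_trans r1.
have p1 : (1 < p)%R by exact: lt_trans rp.
have p10 : (0 < p - 1)%R by rewrite subr_gt0.
have p0 : (0 < p)%R by exact: lt_trans p1.
have pr0 : (0 < p - r)%R by rewrite subr_gt0.
pose t := ((p - r) / (p - 1))%R; pose s := (p / r)%R; pose q := (p / (p - 1))%R.
have t0 : (0 < t)%R by rewrite divr_gt0.
have t1E : (1 - t = (r - 1) / (p - 1))%R by rewrite /t; field; rewrite gt_eqF.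
have t1 : (0 < 1 - t)%R by rewrite t1E divr_gt0// subr_gt0.
have s1 : (1 < s)%R by rewrite ltr_pdivlMr// mul1r.
have q1 : (1 < q)%R by rewrite ltr_pdivlMr// mul1r ltrBlDr ltrDl.
have qE : (t * (s / (s - 1)) = q)%R.
  rewrite /t /s /q; field.
  by apply/and3P; split; rewrite ?mulN1r gt_eqF.
have K'0 : (0 < K `^ (p - 1)^-1)%R by rewrite powR_gt0.
have [C1 [C10 HD]] := doob_weighted q1 K'0.
(* 3^r is the conditional Hoelder constant raised to the power r, and K^(1-t) comes from the A_p
   condition. [eps] below is fixed by B C1 eps = 1/2, which lets half of the left side absorb a
   term. *)
pose B := (3 `^ r * K `^ (1 - t))%R.
have B0 : (0 < B)%R by rewrite mulr_gt0 ?powR_gt0.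
pose eps := ((2 * (B * C1))^-1)%R.
have eps0 : (0 < eps)%R by rewrite invr_gt0 mulr_gt0// mulr_gt0.
exists (2 * B * eps `^ (1 - s))%R; split; first by rewrite !mulr_gt0// powR_gt0.
move=> w sg hA wfin g lam hg lam0; have hfin := Apair_fine p1 hA.
have hAs := Apair_sym p1 hA; have [hw hs hsg hae] := hA.
pose Y := sumpow r (fun k => E k (g k)).
have hY : nnm Y by apply: sumpow_nnm => k; exact: condE_nnm.
pose b x := if lam%:E < Y x then (w x)%:E else 0.
have hwn := weight_nnm hw.
have hb : nnm b by apply: nnm_if => //; exact: measurable_gt.
have bw x : b x <= (w x)%:E by rewrite /b; case: ifP => // _; exact: hwn.2.
have bfin : \int[P]_x b x < +oo by apply: le_lt_trans wfin; apply: nnm_le_int => //; exact: aeW.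
have hH := maxE_nnm hb; pose H := maxE b.
pose pwsg x := H x `^ q * (sg x)%:E.
have hpw : nnm pwsg by apply: nnmM; [exact: nnm_pow|exact: weight_nnm].
(* Weighted Doob for the dual pair (sg, w) at exponent q = p': on the level set b = w, and w^q sg =
   w. *)
have HDb : \int[P]_x pwsg x <= C1%:E * \int[P]_x b x.
  apply: le_trans (HD _ _ _ hAs hb) _; apply: lee_wpmul2l; first by rewrite lee_fin ltW.
  rewrite le_eqVlt; apply/orP; left; apply/eqP; apply: eq_integral => x _.
  rewrite /b; case: ifP => _; last by rewrite poweR0r ?mul0e// gt_eqF// (lt_trans _ q1).
  have w0 := hw.2 x; rewrite poweR_EFin -EFinM hsg -powRD_gt0//.
  congr EFin; rewrite -[RHS]powRr1 ?(ltW w0)//; congr (_ `^ _)%R.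
  by rewrite /q; field; rewrite gt_eqF.
have Hfin : {ae P, forall x, H x < +oo}.
  have pfin : \int[P]_x pwsg x < +oo.
    by apply: le_lt_trans HDb _; rewrite lte_mul_pinfty// ?lee_fin ?(ltW C10)// ge0_fin_numE// integral_ge0// => x _; exact: hb.2.
  have := nnm_int_lty hpw pfin; apply: filter_app; apply: aeW => x.
  by apply: lty_of_poweR_mul; [exact: lt_trans q1|exact: hs.2|exact: hH.2].
(* By [Hfin] this changes H only on a null set. *)
pose Hr x := fine (H x).
have Hr0 x : (0 <= Hr x)%R by apply: fine_ge0; exact: hH.2.
pose V x := (Hr x `^ t * w x `^ (1 - t))%R.
have mpow (f : T -> R) (a : R) : measurable_fun setT f -> measurable_fun setT (fun x => f x `^ a)%R.
  by move=> mf; exact: (measurableT_comp (measurable_powR a)).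
have mHr : measurable_fun setT Hr.
  by apply: (measurableT_comp (fine_measurable measurableT)); exact: hH.1.
have hV : nnm (fun x => (V x)%:E).
  apply: nnm_EFin => [|x]; last by rewrite mulr_ge0 ?powR_ge0.
  by apply: measurable_funM; apply: mpow => //; exact: hw.1.
pose a k x := g k x `^ r * (V x)%:E.
have ha k : nnm (a k) by apply: nnmM => //; exact: nnm_pow.
have rV0 : (0 < r^-1 < 1)%R by rewrite invr_gt0 r0 invf_lt1.
have sgn := weight_nnm hs.
(* The exponent t is chosen so that the powers of w cancel in (g^r V)^(1/r) sg^(1-1/r) = H^(t/r) g,
   which dominates (E_k b)^(t/r) g. Hoelder under E_k, with the first factor pulled out, then bounds
   (E_k b)^t (E_k g)^r. *)
have key k : {ae P, forall x, E k (g k) x `^ r * E k b x <= B%:E * E k (a k) x}.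
  pose X x := E k b x `^ (t / r).
  have hX : Fnnm k X by apply: Fnnm_pow; exact: condE_Fnnm.
  have hXn := Fnnm_nnm hX.
  pose f2 x := a k x `^ r^-1 * (sg x)%:E `^ (1 - r^-1).
  have hf2 : nnm f2 by apply: nnmM; exact: nnm_pow.
  have mono : {ae P, forall x, X x * g k x <= f2 x}.
    move: Hfin; apply: filter_app; apply: aeW => x Hx.
    have HE : H x = (Hr x)%:E by rewrite fineK// ge0_fin_numE// hH.2.
    have w0 := hw.2 x.
    have -> : f2 x = (Hr x `^ (t / r))%:E * g k x.
      rewrite /f2 /a poweRM ?poweR_ge0 ?hV.2// -poweRrM mulfV ?gt_eqF// poweRe1 ?(hg k).2//.
      rewrite -muleA muleC; congr (_ * _); rewrite !poweR_EFin -EFinM; congr EFin.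
      rewrite /V powRM ?powR_ge0// -!powRrM (Apair_pow _ _ hA) -mulrA -powRD_gt0//.
      rewrite (_ : _ + _ = 0)%R ?powRr0 ?mulr1// t1E.
      by field; rewrite !gt_eqF.
    apply: lee_wpmul2r; first exact: (hg k).2.
    rewrite -poweR_EFin -HE; apply: le_poweR; [by rewrite divr_ge0// ltW|exact: (condE_nnm k hb).2|exact: maxE_ge].
  have := condE_mono k (nnmM hXn (hg k)) hf2 mono; apply: filter_app.
  have := pull_out hX (hg k); apply: filter_app.
  have hfin2 : {ae P, forall x, E k (fun y => (sg y)%:E) x < +oo /\
      (E k (a k) x < +oo \/ 0 < E k (fun y => (sg y)%:E) x)}.
    have := hfin k; apply: filter_app; apply: aeW => x [e [s' [_ s0 _ -> _]]].
    by split; [rewrite ltry|right; rewrite lte_fin].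
  have := condE_holder rV0 (ha k) sgn hfin2; apply: filter_app.
  have := condE_mono k hb hwn (aeW _ bw); apply: filter_app.
  have := hfin k; apply: filter_app.
  apply: aeW => x [e [s' [e0 s0 eE sE hK]]]; rewrite eE sE => be hol po mo.
  have {mo hol po} : X x * E k (g k) x <= 3%:E * (E k (a k) x `^ r^-1 * s'%:E `^ (1 - r^-1)).
    by rewrite -po (le_trans mo).
  set G := E k (g k) x; set A := E k (a k) x; set c := E k b x.
  have G0 : 0 <= G by exact: (condE_nnm k (hg k)).2.
  have A0 : 0 <= A by exact: (condE_nnm k (ha k)).2.
  have c0 : 0 <= c by exact: (condE_nnm k hb).2.
  move/(le_poweR (ltW r0) (mule_ge0 (hXn.2 x) G0)).
  rewrite !poweRM ?mule_ge0 ?poweR_ge0 ?hXn.2// -!poweRrM mulVf ?gt_eqF// poweRe1//.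
  rewrite divfK ?gt_eqF// mulrBl mul1r mulVf ?gt_eqF// !poweR_EFin => h1.
  (* The remaining power 1 - t of E_k b is bounded by that of E_k w and meets (E_k sg)^(r-1) = (E_k
     sg)^((p-1)(1-t)), so the A_p condition applies. *)
  have cE : c = c `^ t * c `^ (1 - t).
    rewrite -poweRD ?subrKC ?poweRe1//; apply: add_neq0_poweRD_def.
    by rewrite subrKC oner_eq0.
  rewrite [X in _ * X]cE muleA [G `^ r * _]muleC.
  apply: (@le_trans _ _ ((3 `^ r)%:E * (A * (s' `^ (r - 1))%:E) * (e `^ (1 - t))%:E)).
    apply: lee_pmul => //; [by rewrite mule_ge0 ?poweR_ge0|exact: poweR_ge0|].
    by rewrite -poweR_EFin; apply: le_poweR => //; exact: ltW.
  rewrite /B EFinM -!muleA; apply: lee_wpmul2l; first by rewrite lee_fin powR_ge0.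
  rewrite muleC; apply: lee_wpmul2r => //.
  have se0 : (0 <= e * s' `^ (p - 1))%R by rewrite mulr_ge0 ?powR_ge0// ltW.
  rewrite -EFinM lee_fin (_ : _ * _ = (e * s' `^ (p - 1)) `^ (1 - t))%R; last first.
    rewrite powRM ?powR_ge0 ?(ltW e0)// -powRrM mulrC; congr (_ * _ `^ _)%R.
    by rewrite t1E mulrC divfK// gt_eqF.
  by rewrite ge0_ler_powR ?nnegrE ?(ltW t1)// (le_trans se0).
pose I := \int[P]_x b x; pose Z := sumpow r g; have hZ : nnm Z by exact: sumpow_nnm.
pose J := \int[P]_x (Z x `^ s * (w x)%:E).
have hJ : nnm (fun x => Z x `^ s * (w x)%:E) by apply: nnmM => //; exact: nnm_pow.
have I0 : 0 <= I by apply: integral_ge0 => x _; exact: hb.2.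
have Ifin : I \is a fin_num by rewrite ge0_fin_numE.
(* Chebyshev on the level set. Each (E_k g)^r is F_k-measurable, so b may be replaced by E_k b and
   [key] applies term by term. *)
have step1 : lam%:E * I <= B%:E * \int[P]_x (Z x * (V x)%:E).
  rewrite -nnm_int_scale ?(ltW lam0)//.
  have hEg k : Fnnm k (fun x => E k (g k) x `^ r) by apply: Fnnm_pow; exact: condE_Fnnm.
  apply: (@le_trans _ _ (\int[P]_x (\sum_(k <oo) (E k (g k) x `^ r * b x)))).
    apply: nnm_le_int.
    - by apply: nnmM => //; apply: nnm_cst; rewrite lee_fin ltW.
    - by apply: nnm_sum => k; apply: nnmM => //; exact: (Fnnm_nnm (hEg k)).
    apply: aeW => x; rewrite /b; case: ifP => [lY|_]; last by rewrite mule0 nneseries_ge0// => k _ _; rewrite mule0.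
    under eq_eseriesr do rewrite muleC.
    rewrite nneseriesZl; last by move=> k _; exact: poweR_ge0.
    by rewrite muleC; apply: lee_wpmul2l; [exact: hwn.2|exact: ltW].
  rewrite nnm_int_sum; last by move=> k; apply: nnmM => //; exact: (Fnnm_nnm (hEg k)).
  apply: (@le_trans _ _ (\sum_(k <oo) (B%:E * \int[P]_x a k x))).
    apply: lee_nneseries => [k _ _|k _].
      by apply: integral_ge0 => x _; rewrite mule_ge0 ?poweR_ge0 ?hb.2.
    rewrite (pull_out_int (hEg k) hb) -(condE_intT k (ha k)).
    rewrite -nnm_int_scale ?(ltW B0)//; last exact: condE_nnm.
    apply: nnm_le_int => //.
    - by apply: nnmM; [exact: (Fnnm_nnm (hEg k))|exact: condE_nnm].
    - by apply: nnmM; [apply: nnm_cst; rewrite lee_fin ltW|exact: condE_nnm].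
  rewrite nneseriesZl; last by move=> k _; apply: integral_ge0 => x _; exact: (ha k).2.
  rewrite -nnm_int_sum//; apply: lee_wpmul2l; first by rewrite lee_fin ltW.
  rewrite le_eqVlt; apply/orP; left; apply/eqP; apply: eq_integral => x _.
  rewrite /a; under eq_eseriesr do rewrite muleC.
  rewrite nneseriesZl; first by rewrite [RHS]muleC.
  by move=> k _; exact: poweR_ge0.
have c0 : (0 < lam * eps)%R by rewrite mulr_gt0.
(* Young with exponent s = p / r against u = H^t w^-t, whose conjugate power times w is H^q sg. The
   parameter is proportional to lam so that the first term scales like the left side of [step1]. *)
have step2 : \int[P]_x (Z x * (V x)%:E) <=
    (lam * eps)%:E * (C1%:E * I) + ((lam * eps) `^ (1 - s))%:E * J.
  have h1 : nnm (fun x => (lam * eps)%:E * pwsg x).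
    by apply: nnmM => //; apply: nnm_cst; rewrite lee_fin ltW.
  have h2 : nnm (fun x => ((lam * eps) `^ (1 - s))%:E * (Z x `^ s * (w x)%:E)).
    by apply: nnmM => //; apply: nnm_cst; rewrite lee_fin powR_ge0.
  apply: (@le_trans _ _ (\int[P]_x ((lam * eps)%:E * pwsg x +
      ((lam * eps) `^ (1 - s))%:E * (Z x `^ s * (w x)%:E)))).
    apply: nnm_le_int; [exact: nnmM|exact: nnmD|].
    move: Hfin; apply: filter_app; apply: aeW => x Hx.
    have HE : H x = (Hr x)%:E by rewrite fineK// ge0_fin_numE// hH.2.
    have w0 := hw.2 x; have := hZ.2 x.
    case: (Z x) => [z| |] //; last first.
      move=> _; apply: (@le_trans _ _ +oo); first exact: leey.
      rewrite poweRyr ?gt_eqF ?(lt_trans _ s1)// [+oo * (w x)%:E]gt0_mulye ?lte_fin//.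
      have hne : (lam * eps)%:E * pwsg x != -oo.
        by rewrite gt_eqF// (@lt_le_trans _ _ 0)// h1.2.
      by rewrite gt0_muley ?lte_fin ?powR_gt0// addey.
    rewrite lee_fin => z0; rewrite /pwsg HE !poweR_EFin -!EFinM -EFinD lee_fin.
    have VE : (V x = Hr x `^ t * w x `^ (- t) * w x)%R.
      rewrite /V -mulrA -[X in (_ * (_ * X))%R](powRr1 (ltW w0)) -powRD_gt0//.
      by rewrite addrC.
    have sgE : (sg x = w x `^ (- q) * w x)%R.
      rewrite hsg -[X in (_ * X)%R](powRr1 (ltW w0)) -powRD_gt0//.
      by congr (_ `^ _)%R; rewrite /q; field; rewrite gt_eqF.
    have u0 : (0 <= Hr x `^ t * w x `^ (- t))%R by rewrite mulr_ge0 ?powR_ge0.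
    have := young_scaled z0 u0 c0 s1.
    rewrite powRM ?powR_ge0// -!powRrM mulNr qE => /(ler_wpM2r (ltW w0)).
    rewrite VE sgE mulrDl => h; rewrite (_ : z * _ = z * (Hr x `^ t * w x `^ (- t)) * w x)%R; last by rewrite !mulrA.
    by apply: le_trans h _; rewrite le_eqVlt; apply/orP; left; apply/eqP; ring.
  rewrite ge0_integralD//; [|by move=> x _; exact: h1.2|exact: h1.1|by move=> x _; exact: h2.2|exact: h2.1].
  rewrite !nnm_int_scale ?powR_ge0 ?(ltW c0)//; apply: leeD => //.
  by apply: lee_wpmul2l => //; rewrite lee_fin ltW.
change (I <= (2 * B * eps `^ (1 - s) * lam `^ (- s))%:E * J).
have := hJ; case: (J) step2 (integral_ge0 P (fun x _ => hJ.2 x) : 0 <= J) => [j| |] //; last first.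
  by move=> _ _ _; rewrite gt0_muley ?leey// lte_fin !mulr_gt0 ?powR_gt0.
move=> step2 j0 _; have := le_trans step1 (lee_wpmul2l (_ : 0 <= B%:E) step2).
move=> /(_ (ltW B0 : 0 <= B%:E)).
(* Absorbing half of I requires I to be finite; this is where the integrability of w enters. *)
have [i iE] : exists i, I = i%:E by exists (fine I); rewrite fineK.
rewrite iE => hi.
have {hi} : (lam * i <= B * (lam * eps * (C1 * i) + (lam * eps) `^ (1 - s) * j))%R.
  by rewrite -lee_fin; exact: hi.
rewrite -EFinM lee_fin.
rewrite powRM ?(ltW lam0) ?(ltW eps0)//.
have lE : (lam `^ (1 - s) = lam * lam `^ (- s))%R.
  by rewrite -[X in (X * _)%R](powRr1 (ltW lam0)) -powRD_gt0.
rewrite lE; set L := (lam `^ _)%R; set e' := (eps `^ _)%R.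
have -> : (B * (lam * eps * (C1 * i) + lam * L * e' * j) =
   lam * ((B * C1 * eps) * i + B * (L * e' * j)))%R by ring.
have -> : (B * C1 * eps = 2^-1)%R.
  by rewrite /eps invfM mulrCA mulfV ?mulr1// gt_eqF// mulr_gt0.
rewrite ler_pM2l// => h.
have -> : (2 * B * e' * L * j = 2 * (B * (L * e' * j)))%R by ring.
by move: h; set u := (B * _)%R; lra.
Qed.

(** A strong-type bound is proved, and Chebyshev comes last. Since (r - p) p / r = p (1 - p/r),
    Young applied to the power p/r of the three-factor bound separates (M U)^p, controlled by
    weighted Doob, from [Th], whose integral against w is computed exactly term by term. *)
Lemma weak_type_below (p r K : R) : (1 < p)%R -> (p < r)%R -> (0 < K)%R ->
  exists C : R, (0 < C)%R /\ forall w sg, Apair p K w sg ->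
  forall (g : nat -> T -> \bar R) (lam : R),
  (forall k, nnm (g k)) -> (0 < lam)%R ->
  \int[P]_x (if lam%:E < sumpow r (fun k => E k (g k)) x then (w x)%:E else 0) <=
  (C * lam `^ (- (p / r)))%:E * \int[P]_x (sumpow r g x `^ (p / r) * (w x)%:E).
Proof.
move=> p1 pr K0; have r1 : (1 < r)%R by exact: lt_trans pr.
have r0 : (0 < r)%R by exact: lt_trans r1.
have p0 : (0 < p)%R by exact: lt_trans p1.
have p10 : (0 < p - 1)%R by rewrite subr_gt0.
have r10 : (0 < r - 1)%R by rewrite subr_gt0.
have rp0 : (0 < r - p)%R by rewrite subr_gt0.
have q0 : (0 < p / r)%R by rewrite divr_gt0.
have q1 : (p / r < 1)%R by rewrite ltr_pdivrMr// mul1r.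
pose th := ((r - p) / (r - 1))%R.
have th0 : (0 < th)%R by rewrite divr_gt0.
have th1E : (1 - th = (p - 1) / (r - 1))%R by rewrite /th; field; rewrite gt_eqF.
have th1 : (0 < 1 - th)%R by rewrite th1E divr_gt0.
have [C1 [C10 HD]] := doob_weighted p1 K0.
(* Three factors need two nested conditional Hoelder inequalities: 3^r comes from the outer one and
   3^(r-1) from the inner one; K is the A_p constant. *)
pose B := (3 `^ r * 3 `^ (r - 1) * K)%R.
have B0 : (0 < B)%R by rewrite !mulr_gt0 ?powR_gt0.
have BC0 : (0 < B `^ (p / r) * (C1 + 1))%R by rewrite mulr_gt0 ?powR_gt0// addr_gt0.
exists (B `^ (p / r) * (C1 + 1))%R; split=> //.
move=> w sg hA g lam hg lam0; have hfin := Apair_fine p1 hA.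
have [hw hs hsg hae] := hA; have hwn := weight_nnm hw; have sgn := weight_nnm hs.
pose Y := sumpow r (fun k => E k (g k)).
have hY : nnm Y by apply: sumpow_nnm => k; exact: condE_nnm.
pose Z := sumpow r g; have hZ : nnm Z by exact: sumpow_nnm.
have hJ : nnm (fun x => Z x `^ (p / r) * (w x)%:E) by apply: nnmM => //; exact: nnm_pow.
set J := \int[P]_x (sumpow r g x `^ (p / r) * (w x)%:E).
have J0 : 0 <= J by apply: integral_ge0 => x _; exact: hJ.2.
have [Joo|Jfin] := eqVneq J +oo.
  by rewrite Joo gt0_muley ?leey// lte_fin mulr_gt0// powR_gt0.
have {}Jfin : J < +oo by rewrite ltey.
have Zfin : {ae P, forall x, Z x < +oo}.
  have := nnm_int_lty hJ Jfin; apply: filter_app; apply: aeW => x.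
  by apply: lty_of_poweR_mul => //; [exact: hw.2|exact: hZ.2].
pose z x := fine (Z x).
have z0 x : (0 <= z x)%R by apply: fine_ge0; exact: hZ.2.
have zZ x : (z x)%:E <= Z x.
  by rewrite /z; case: (Z x) (hZ.2 x) => [h| |] //= _; rewrite leey.
have mz : measurable_fun setT z.
  by apply: (measurableT_comp (fine_measurable measurableT)); exact: hZ.1.
have zpow (q : R) : nnm (fun x => (z x `^ q)%:E).
  apply: nnm_EFin => [|x]; last exact: powR_ge0.
  exact: (measurableT_comp (measurable_powR q)).
pose U x := (z x `^ r^-1)%:E; have hU : nnm U by exact: zpow.
have hM := maxE_nnm hU; set M := maxE U in hM.
have hMp : nnm (fun x => M x `^ p * (w x)%:E) by apply: nnmM => //; exact: nnm_pow.
have MJ : \int[P]_x (M x `^ p * (w x)%:E) <= C1%:E * J.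
  apply: le_trans (HD _ _ _ hA hU) _; apply: lee_wpmul2l; first by rewrite lee_fin ltW.
  apply: nnm_le_int => //; first by apply: nnmM => //; exact: nnm_pow.
  apply: aeW => x; apply: lee_wpmul2r; first by rewrite lee_fin ltW// hw.2.
  rewrite /U poweR_EFin -powRrM mulrC -poweR_EFin; apply: le_poweR => //; first exact: ltW.
  by rewrite lee_fin.
have Mfin : {ae P, forall x, M x < +oo}.
  have Mint : \int[P]_x (M x `^ p * (w x)%:E) < +oo.
    apply: le_lt_trans MJ _; rewrite lte_mul_pinfty ?lee_fin ?(ltW C10)//.
  have := nnm_int_lty hMp Mint; apply: filter_app; apply: aeW => x.
  by apply: lty_of_poweR_mul => //; [exact: hw.2|exact: hM.2].
pose a k x := g k x `^ r * ((z x `^ ((p - r) / r))%:E * (w x)%:E).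
have ha k : nnm (a k) by apply: nnmM; [exact: nnm_pow|apply: nnmM].
have aJ : \int[P]_x (\sum_(k <oo) a k x) <= J.
  apply: nnm_le_int => //; first exact: nnm_sum.
  move: Zfin; apply: filter_app; apply: aeW => x Zx.
  have ZE : Z x = (z x)%:E by rewrite fineK// ge0_fin_numE// hZ.2.
  rewrite /a; under eq_eseriesr do rewrite -EFinM muleC.
  rewrite nneseriesZl; last by move=> k _; exact: poweR_ge0.
  rewrite -/(sumpow r g x) -/(Z x) ZE poweR_EFin -!EFinM lee_fin.
  rewrite mulrAC ler_wpM2r ?(ltW (hw.2 x))// mulrC.
  have [->|zx0] := eqVneq (z x) 0%R; first by rewrite mul0r powR_ge0.
  rewrite -[X in (X * _)%R](powRr1 (z0 x)) -powRD ?zx0 ?implybT//.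
  by rewrite (_ : 1 + _ = p / r)%R//; field; rewrite gt_eqF.
have Afin k : {ae P, forall x, E k (a k) x < +oo}.
  apply: condE_lty => //; apply: le_lt_trans Jfin; apply: le_trans aJ.
  rewrite nnm_int_sum//.
  apply: le_trans (@nneseries_lim_ge _ (fun k => \int[P]_x a k x) xpredT 0%N k.+1 _).
    by rewrite big_nat_recr//= leeDr// sume_ge0// => i _; apply: integral_ge0 => x _; exact: (ha i).2.
  by move=> i _ _; apply: integral_ge0 => x _; exact: (ha i).2.
have rV0 : (0 < r^-1 < 1)%R by rewrite invr_gt0 r0 invf_lt1.
have rV1 : (0 < 1 - r^-1)%R by rewrite subr_gt0; case/andP: rV0.
have thb : (0 < th < 1)%R by rewrite th0 -subr_gt0.
(* [th] is chosen so that, where 0 < Z < +oo, the powers of z and of w cancel and g_k = a_k^(1/r)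
   Bf^(1-1/r). *)
pose Bf x := U x `^ th * (sg x)%:E `^ (1 - th).
have hBf : nnm Bf by apply: nnmM; exact: nnm_pow.
pose X k x := E k (a k) x * rinv (E k (fun y => (w y)%:E) x).
have hX k : Fnnm k (X k).
  by apply: FnnmM; [exact: condE_Fnnm|apply: Fnnm_rinv; exact: condE_Fnnm].
have key k : {ae P, forall x, E k (g k) x `^ r <= (B * fine (M x) `^ (r - p))%:E * X k x}.
  pose f2 x := a k x `^ r^-1 * Bf x `^ (1 - r^-1).
  have hf2 : nnm f2 by apply: nnmM; exact: nnm_pow.
  have mono : {ae P, forall x, g k x <= f2 x}.
    move: Zfin; apply: filter_app; apply: aeW => x Zx.
    have w0 := hw.2 x.
    (* Exponents of z cannot be added where z = 0, but there g_k = 0. *)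
    have [zx0|zx0] := eqVneq (z x) 0%R.
      have Z0 : Z x = 0 by rewrite -[Z x]fineK ?ge0_fin_numE ?hZ.2// -/(z x) zx0.
      have : g k x `^ r <= Z x.
        apply: le_trans (@nneseries_lim_ge _ (fun k => g k x `^ r) xpredT 0%N k.+1 _).
          by rewrite big_nat_recr//= leeDr// sume_ge0// => i _; exact: poweR_ge0.
        by move=> i _ _; exact: poweR_ge0.
      rewrite Z0 => h; have /poweR_eq0_eq0 -> : g k x `^ r = 0.
        by apply/eqP; rewrite eq_le h poweR_ge0.
      - exact: hf2.2.
      - exact: (hg k).2.
    have zpos : (0 < z x)%R by rewrite lt0r zx0 z0.
    have -> // : f2 x = g k x.
    rewrite /f2 /a /Bf !poweRM ?mule_ge0 ?poweR_ge0 ?lee_fin ?powR_ge0 ?(ltW w0) ?(ltW (hs.2 x))//.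
    rewrite -[(g k x `^ r) `^ r^-1]poweRrM mulfV ?gt_eqF// poweRe1 ?(hg k).2//.
    rewrite -muleA /U !poweR_EFin -!EFinM -[RHS]mule1; congr (_ * _); congr EFin.
    rewrite -!powRrM (Apair_pow _ _ hA) mulrACA -(powRD_gt0 _ _ w0).
    rewrite -(powRD_gt0 _ _ zpos).
    rewrite (_ : _ + _ = 0)%R; last by rewrite /th; field; rewrite !gt_eqF.
    rewrite (_ : _ + _ = 0)%R; last by rewrite th1E; field; rewrite !gt_eqF.
    by rewrite !powRr0 mulr1.
  have hfin2 : {ae P, forall x, E k (fun y => (sg y)%:E) x < +oo /\
      (E k U x < +oo \/ 0 < E k (fun y => (sg y)%:E) x)}.
    have := hfin k; apply: filter_app; apply: aeW => x [e [s' [_ s0 _ -> _]]].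
    by split; [rewrite ltry|right; rewrite lte_fin].
  have hol2 := condE_holder thb hU sgn hfin2.
  have bound : {ae P, forall x, E k Bf x <= 3%:E * (M x `^ th * E k (fun y => (sg y)%:E) x `^ (1 - th))}.
    move: hol2; apply: filter_app; apply: aeW => x h; apply: le_trans h _.
    apply: lee_wpmul2l => //; apply: lee_wpmul2r; first exact: poweR_ge0.
    by apply: le_poweR; [exact: ltW|exact: (condE_nnm k hU).2|exact: maxE_ge].
  have hfin1 : {ae P, forall x, E k Bf x < +oo /\ (E k (a k) x < +oo \/ 0 < E k Bf x)}.
    have := Afin k; apply: filter_app; move: bound; apply: filter_app.
    move: Mfin; apply: filter_app; have := hfin k; apply: filter_app.
    apply: aeW => x [e [s' [_ s0 _ -> _]]] Mx bd Ax; split; last by left.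
    apply: le_lt_trans bd _; rewrite poweR_EFin.
    have : M x \is a fin_num by rewrite ge0_fin_numE// hM.2.
    by move=> /fineK <-; rewrite poweR_EFin -!EFinM ltry.
  have := condE_holder rV0 (ha k) hBf hfin1; apply: filter_app.
  have := condE_mono k (hg k) hf2 mono; apply: filter_app.
  move: bound; apply: filter_app; move: Mfin; apply: filter_app.
  have := hfin k; apply: filter_app.
  apply: aeW => x [e [s' [e0 s0 eE sE hK]]] Mx bd h1 h2; rewrite sE in bd.
  have [m ME] : exists m, M x = m%:E.
    by exists (fine (M x)); rewrite fineK// ge0_fin_numE// hM.2.
  have M0 : (0 <= m)%R by rewrite -lee_fin -ME hM.2.
  rewrite ME /= in bd *.
  rewrite /X /rinv eE /= powR_inv1 ?(ltW e0)//.
  have G0 : 0 <= E k (g k) x by exact: (condE_nnm k (hg k)).2.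
  have A0 : 0 <= E k (a k) x by exact: (condE_nnm k (ha k)).2.
  have Bf0 : 0 <= E k Bf x by exact: (condE_nnm k hBf).2.
  have h4 : E k Bf x `^ (r - 1) <= (3 `^ (r - 1) * (m `^ (r - p) * s' `^ (p - 1)))%:E.
    apply: le_trans (le_poweR (ltW r10) Bf0 bd) _; rewrite le_eqVlt; apply/orP; left; apply/eqP.
    rewrite -!EFinM poweR_EFin; congr EFin.
    rewrite !powRM ?mulr_ge0 ?powR_ge0// -!powRrM th1E /th.
    by rewrite !divfK ?gt_eqF.
  have h3 := le_poweR (ltW r0) G0 (le_trans h1 h2); apply: le_trans h3 _.
  rewrite !poweRM ?mule_ge0 ?poweR_ge0// -!poweRrM mulVf ?gt_eqF// poweRe1//.
  rewrite mulrBl mul1r mulVf ?gt_eqF// poweR_EFin.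
  apply: (@le_trans _ _ ((3 `^ r)%:E * (E k (a k) x *
      (3 `^ (r - 1) * (m `^ (r - p) * s' `^ (p - 1)))%:E))).
    apply: lee_wpmul2l; first by rewrite lee_fin powR_ge0.
    exact: lee_wpmul2l.
  rewrite muleCA [leRHS]muleCA -!EFinM; apply: lee_wpmul2l => //; rewrite lee_fin.
  have : (s' `^ (p - 1) <= K * e^-1)%R by rewrite ler_pdivlMr// mulrC.
  have c0 : (0 <= 3 `^ r * 3 `^ (r - 1) * m `^ (r - p))%R by rewrite !mulr_ge0 ?powR_ge0.
  move=> /(ler_wpM2l c0) h5.
  apply: le_trans (le_trans _ h5) _; rewrite le_eqVlt; apply/orP; left; apply/eqP.
    by ring.
  by rewrite /B; ring.
pose Th x := \sum_(k <oo) X k x.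
have hTh : nnm Th by apply: nnm_sum => k; exact: Fnnm_nnm.
(* X_k is F_k-measurable, so w may be replaced by E_k w, which cancels the denominator of X_k and
   leaves the integral of a_k. *)
have ThJ : \int[P]_x (Th x * (w x)%:E) <= J.
  apply: le_trans aJ.
  under eq_integral.
    move=> x _; rewrite /Th muleC -nneseriesZl; last by move=> k _; exact: (Fnnm_nnm (hX k)).2.
    under eq_eseriesr do rewrite muleC.
    over.
  rewrite nnm_int_sum; last by move=> k; apply: nnmM => //; exact: Fnnm_nnm.
  rewrite nnm_int_sum//; apply: lee_nneseries => [k _ _|k _].
    by apply: integral_ge0 => x _; rewrite mule_ge0 ?hwn.2//; exact: (Fnnm_nnm (hX k)).2.
  rewrite (pull_out_int (hX k) hwn) -(condE_intT k (ha k)).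
  apply: nnm_le_int.
  - by apply: nnmM; [exact: Fnnm_nnm|exact: condE_nnm].
  - exact: condE_nnm.
  have := hfin k; apply: filter_app; apply: aeW => x [e [s' [e0 _ eE _ _]]].
  rewrite /X /rinv eE /= powR_inv1 ?(ltW e0)// -muleA -EFinM mulVf ?gt_eqF//.
  by rewrite mule1.
have Ybound : {ae P, forall x, Y x `^ (p / r) <= (B `^ (p / r))%:E * (M x `^ p + Th x)}.
  have := ae_foralln key; apply: filter_app; move: Mfin; apply: filter_app.
  apply: aeW => x Mx hx.
  have M0 : (0 <= fine (M x))%R by apply: fine_ge0; exact: hM.2.
  have ME : M x = (fine (M x))%:E by rewrite fineK// ge0_fin_numE// hM.2.
  have YT : Y x <= (B * fine (M x) `^ (r - p))%:E * Th x.
    rewrite /Th -nneseriesZl; last by move=> k _; exact: (Fnnm_nnm (hX k)).2.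
    by apply: lee_nneseries => [k _ _|k _]; [exact: poweR_ge0|exact: hx].
  have := le_poweR (ltW q0) (hY.2 x) YT.
  rewrite poweRM ?hTh.2 ?lee_fin ?mulr_ge0 ?powR_ge0 ?(ltW B0) ?(ltW K0)//.
  rewrite poweR_EFin powRM ?powR_ge0 ?(ltW B0)// EFinM -muleA => h; apply: le_trans h _.
  apply: lee_wpmul2l; first by rewrite lee_fin powR_ge0.
  have th' : (0 < 1 - p / r < 1)%R by rewrite subr_gt0 q1/= gtrBl.
  have Mp0 : 0 <= M x `^ p by exact: poweR_ge0.
  have := lossy_young Mp0 (hTh.2 x) (@lte01 R) th'.
  rewrite !powR1 !mul1e subKr -poweRrM.
  rewrite ME !poweR_EFin -powRrM.
  by rewrite (_ : (r - p) * (p / r) = p * (1 - p / r))%R//; field; rewrite gt_eqF.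
have hYw : nnm (fun x => Y x `^ (p / r) * (w x)%:E) by apply: nnmM => //; exact: nnm_pow.
have YJ : \int[P]_x (Y x `^ (p / r) * (w x)%:E) <= (B `^ (p / r) * (C1 + 1))%:E * J.
  have h2 : nnm (fun x => Th x * (w x)%:E) by exact: nnmM.
  apply: (@le_trans _ _ (\int[P]_x ((B `^ (p / r))%:E *
      (M x `^ p * (w x)%:E + Th x * (w x)%:E)))).
    apply: nnm_le_int => //.
      by apply: nnmM; [apply: nnm_cst; rewrite lee_fin powR_ge0|exact: nnmD].
    move: Ybound; apply: filter_app; apply: aeW => x h.
    have := lee_wpmul2r (hwn.2 x) h.
    by rewrite -muleA ge0_muleDl// ?poweR_ge0// ?hTh.2.
  rewrite nnm_int_scale ?powR_ge0//; last exact: nnmD.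
  rewrite EFinM -muleA; apply: lee_wpmul2l; first by rewrite lee_fin powR_ge0.
  rewrite ge0_integralD//; [|by move=> x _; exact: hMp.2|exact: hMp.1|by move=> x _; exact: h2.2|exact: h2.1].
  rewrite EFinD ge0_muleDl ?lee_fin ?(ltW C10)// mul1e; exact: leeD.
apply: (@le_trans _ _ ((lam `^ (- (p / r)))%:E * \int[P]_x (Y x `^ (p / r) * (w x)%:E))); last first.
  rewrite [(_ * lam `^ _)%R]mulrC EFinM -[leRHS]muleA; apply: lee_wpmul2l => //.
  by rewrite lee_fin powR_ge0.
rewrite -nnm_int_scale ?powR_ge0//; apply: nnm_le_int.
- by apply: nnm_if => //; exact: measurable_gt.
- by apply: nnmM => //; apply: nnm_cst; rewrite lee_fin powR_ge0.
apply: aeW => x; rewrite -/(Y x); case: ifP => [lY|_]; last first.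
  by rewrite mule_ge0 ?lee_fin ?powR_ge0// hYw.2.
rewrite muleA -[leLHS]mul1e; apply: lee_wpmul2r; first exact: hwn.2.
have := le_poweR (ltW q0) (ltW lam0 : 0 <= lam%:E) (ltW lY); rewrite poweR_EFin.
move=> /(lee_wpmul2l (_ : 0 <= (lam `^ (- (p / r)))%:E)) h; apply: le_trans (h _).
  by rewrite -EFinM mulrC powR_div_id.
by rewrite lee_fin powR_ge0.
Qed.

Lemma weak_type (p r K : R) : (1 < p)%R -> (1 < r)%R -> p != r -> (0 < K)%R ->
  exists C : R, (0 < C)%R /\ forall w sg, Apair p K w sg ->
  \int[P]_x (w x)%:E < +oo -> forall (g : nat -> T -> \bar R) (lam : R),
  (forall k, nnm (g k)) -> (0 < lam)%R ->
  \int[P]_x (if lam%:E < sumpow r (fun k => E k (g k)) x then (w x)%:E else 0) <=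
  (C * lam `^ (- (p / r)))%:E * \int[P]_x (sumpow r g x `^ (p / r) * (w x)%:E).
Proof.
move=> p1 r1 pr K0; move: pr; rewrite neq_lt => /orP[pr|rp].
  have [C [C0 H]] := weak_type_below p1 pr K0.
  by exists C; split=> // w sg hA _; exact: H hA.
exact: weak_type_above.
Qed.

(** * From A_q conditions on phi to A_p pairs, uniformly in t *)

Lemma condE_cst n (c : R) : (0 <= c)%R -> {ae P, forall x, E n (fun=> c%:E) x = c%:E}.
Proof. by move=> c0; apply: condE_id; apply: Fnnm_cst; rewrite lee_fin. Qed.

(** The A_1 bound says (E_k w)^(1/(p-1)) sg <= K^(1/(p-1)) pointwise. Taking E_k, pulling out the
    first factor and raising to the power p - 1 gives A_p. *)
Lemma Apair_of_A1 phi (p : R) : MO_function P phi -> A1 P E phi -> (1 < p)%R ->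
  exists K : R, (0 < K)%R /\ forall t, (0 < t)%R ->
    Apair p K (phi ^~ t) (fun x => phi x t `^ (- (p - 1)^-1))%R.
Proof.
move=> hMO [K0 hK0] p1; have p10 : (0 < p - 1)%R by rewrite subr_gt0.
pose K := Num.max K0 1%R; have K1 : (0 < K)%R by rewrite lt_max ltr01 orbT.
exists K; split=> // t t0; have hw := MO_weight hMO t0; have hwn := weight_nnm hw.
have hs := weight_pow (- (p - 1)^-1) hw; have hsn := weight_nnm hs.
split=> // k; set w := phi ^~ t in hw hwn *; set sg := (fun x => _) in hs hsn *.
pose X x := E k (fun y => (w y)%:E) x `^ (p - 1)^-1.
have hX : Fnnm k X by apply: Fnnm_pow; exact: condE_Fnnm.
have cK0 : (0 <= K `^ (p - 1)^-1)%R by exact: powR_ge0.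
have wfin := condE_lty k hwn (MO_int hMO t0).
have wpos := weight_condE_gt0 k hw.
have Xs : {ae P, forall x, X x * (sg x)%:E <= (K `^ (p - 1)^-1)%:E}.
  have := hK0 k; apply: filter_app; move: wfin; apply: filter_app.
  apply: aeW => x wy hx; have w0 := hw.2 x; have := hx t t0; rewrite /X -/w.
  have e0 := (condE_nnm k hwn).2 x.
  move: e0 wy; case: (E k _ x) => [e| |] // e0 _.
  rewrite -/(w x) -EFinM lee_fin ler_pdivrMr// => h.
  rewrite poweR_EFin -EFinM lee_fin /sg powRN ler_pdivrMr ?powR_gt0//.
  rewrite -powRM ?(ltW K1) ?(ltW w0)// ge0_ler_powR ?nnegrE ?invr_ge0 ?(ltW p10)//.
    by rewrite mulr_ge0// ltW.
  by apply: le_trans h _; rewrite ler_wpM2r ?(ltW w0)// le_max lexx.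
have := condE_mono k (nnmM (Fnnm_nnm hX) hsn) (nnm_cst (_ : 0 <= (K `^ (p - 1)^-1)%:E)) Xs.
rewrite lee_fin => /(_ cK0); apply: filter_app.
have := pull_out hX hsn; apply: filter_app.
have := condE_cst k cK0; apply: filter_app; move: wfin; apply: filter_app.
move: wpos; apply: filter_app; apply: aeW => x wp wy -> ->.
rewrite /X; have s0 := (condE_nnm k hsn).2 x.
move: wp wy; case: (E k _ x) => [e| |] //; rewrite lte_fin => e0 _.
rewrite poweR_EFin.
move: s0; case: (E k _ x) => [s| |] //; last first.
  by move=> _; rewrite gt0_muley ?lte_fin ?powR_gt0// leye_eq.
rewrite lee_fin => s0; rewrite -EFinM lee_fin => h; split; rewrite ?ltry//.
rewrite poweR_EFin -EFinM lee_fin.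
have := ge0_ler_powR (ltW p10) _ _ h; rewrite !nnegrE mulr_ge0 ?powR_ge0//.
move=> /(_ isT isT); rewrite powRM ?powR_ge0// -!powRrM mulVf ?gt_eqF//.
by rewrite !powRr1 ?(ltW e0) ?(ltW K1).
Qed.

(** A Jensen inequality: sg is the power th = (q-1)/(p-1) < 1 of w^(-1/(q-1)), and conditional
    Hoelder against the constant 1 costs 3, hence 3^(p-1) in K. *)
Lemma Apair_of_Aq phi (q p : R) : MO_function P phi -> Aq P E phi q -> (1 < q)%R -> (q < p)%R ->
  exists K : R, (0 < K)%R /\ forall t, (0 < t)%R ->
    Apair p K (phi ^~ t) (fun x => phi x t `^ (- (p - 1)^-1))%R.
Proof.
move=> hMO [K0 hK0] q1 qp; have p1 : (1 < p)%R by exact: lt_trans qp.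
have p10 : (0 < p - 1)%R by rewrite subr_gt0.
have q10 : (0 < q - 1)%R by rewrite subr_gt0.
pose K := (3 `^ (p - 1) * Num.max K0 1)%R.
have K1 : (0 < K)%R by rewrite mulr_gt0 ?powR_gt0// lt_max ltr01 orbT.
exists K; split=> // t t0; have hw := MO_weight hMO t0; have hwn := weight_nnm hw.
have hs := weight_pow (- (p - 1)^-1) hw; have hsn := weight_nnm hs.
split=> // k; set w := phi ^~ t in hw hwn *; set sg := (fun x => _) in hs hsn *.
have hsq := weight_pow (- (q - 1)^-1) hw; have hsqn := weight_nnm hsq.
pose th := ((q - 1) / (p - 1))%R.
have th01 : (0 < th < 1)%R by rewrite divr_gt0//= ltr_pdivrMr// mul1r ltrD2r.
have one0 : nnm (fun _ : T => 1 : \bar R) by exact: nnm_cst.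
have one1 := condE_cst k (@ler01 R).
have hfin : {ae P, forall x, E k (fun=> 1%:E) x < +oo /\
    (E k (fun y => (w y `^ (- (q - 1)^-1))%:E) x < +oo \/ 0 < E k (fun=> 1%:E) x)}.
  by move: one1; apply: filter_app; apply: aeW => x ->; split; [exact: ltry|right].
have := condE_holder th01 hsqn one0 hfin; apply: filter_app.
have := hK0 k; apply: filter_app; move: one1; apply: filter_app.
have := condE_lty k hwn (MO_int hMO t0); apply: filter_app.
have := weight_condE_gt0 k hw; apply: filter_app.
apply: aeW => x wp wy -> /(_ t t0) hq; rewrite poweR1r mule1.
have -> : (fun y => (w y `^ (- (q - 1)^-1))%:E `^ th * 1) = (fun y => (sg y)%:E).
  apply/funext => y; rewrite mule1 poweR_EFin -powRrM; congr (_ `^ _)%:E.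
  by rewrite /th; field; rewrite !gt_eqF.
move: hq wp wy; rewrite -/w; case: (E k (fun y => (w y)%:E) x) => [e| |] //.
move=> hq; rewrite lte_fin => e0 _.
have := (condE_nnm k hsqn).2 x; have := (condE_nnm k hsn).2 x.
move: hq; case: (E k (fun y => (w y `^ _)%:E) x) => [s| |] //; last first.
  by rewrite poweRyr ?gt_eqF// gt0_muley ?lte_fin// leye_eq.
rewrite !poweR_EFin -EFinM -EFinM lee_fin => hq.
case: (E k _ x) => [u| |] //; rewrite !lee_fin => u0 s0 us.
split; rewrite ?ltry//.
have := ge0_ler_powR (ltW p10) _ _ us; rewrite !nnegrE mulr_ge0 ?powR_ge0// => /(_ u0 isT).
rewrite powRM ?powR_ge0// -powRrM /th divfK ?gt_eqF// => h.
apply: (@le_trans _ _ (e * (3 `^ (p - 1) * s `^ (q - 1))))%R; first by rewrite ler_wpM2l// ltW.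
rewrite mulrCA /K ler_wpM2l ?powR_ge0//.
by apply: le_trans hq _; rewrite le_max lexx.
Qed.

(** * Truncation at a level *)

Lemma poweR_add_le (r : R) (x y : \bar R) : (0 <= r)%R -> 0 <= x -> 0 <= y ->
  (x + y) `^ r <= (2 `^ r)%:E * (x `^ r + y `^ r).
Proof.
move=> r0; have main (a b : \bar R) : 0 <= a -> a <= b -> (a + b) `^ r <= (2 `^ r)%:E * (a `^ r + b `^ r).
  move=> a0 ab; have b0 := le_trans a0 ab.
  apply: (@le_trans _ _ ((2%:E * b) `^ r)).
    apply: le_poweR => //; first exact: adde_ge0.
    by rewrite mule_natl mule2n leeD2r.
  rewrite poweRM ?lee_fin// poweR_EFin; apply: lee_wpmul2l; first by rewrite lee_fin powR_ge0.
  by rewrite leeDr// poweR_ge0.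
move=> x0 y0; have [xy|/ltW yx] := leP x y; first exact: main.
by rewrite addeC [X in _ * X]addeC; exact: main.
Qed.

(** All g_k are cut on the same set, according to the size of the full l^r norm z, so that each
    truncated sequence has norm z or 0. The part with z > u goes to the exponent p0, the other to
    p1. *)
Lemma split_bound (p0 p1 r K0 K1 : R) : (1 < p0)%R -> (1 < p1)%R -> (1 < r)%R ->
  p0 != r -> p1 != r -> (0 < K0)%R -> (0 < K1)%R ->
  exists A : R, (0 < A)%R /\ forall w sg0 sg1, Apair p0 K0 w sg0 -> Apair p1 K1 w sg1 ->
  \int[P]_x (w x)%:E < +oo -> forall (g : nat -> T -> \bar R) (u : R),
  (forall k, nnm (g k)) -> (0 < u)%R ->
  \int[P]_x (if u%:E < lrnorm r (fun k => E k (g k)) x then (w x)%:E else 0) <=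
    (A * u `^ (- p0))%:E *
      \int[P]_x (if u%:E < lrnorm r g x then lrnorm r g x `^ p0 * (w x)%:E else 0) +
    (A * u `^ (- p1))%:E *
      \int[P]_x (if lrnorm r g x <= u%:E then lrnorm r g x `^ p1 * (w x)%:E else 0).
Proof.
move=> p01 p11 r1 p0r p1r K00 K10; have r0 : (0 < r)%R by exact: lt_trans r1.
have [C0 [C00 H0]] := weak_type p01 r1 p0r K00.
have [C1 [C10 H1]] := weak_type p11 r1 p1r K10.
pose D (p : R) := ((2 `^ (r + 1)) `^ (p / r))%R.
have D0 p : (0 < D p)%R by rewrite powR_gt0// powR_gt0.
pose A := (C0 * D p0 + C1 * D p1)%R.
have A0 : (0 < A)%R by rewrite addr_gt0// mulr_gt0.
exists A; split=> // w sg0 sg1 hA0 hA1 wfin g u hg u0.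
set y := lrnorm r _; pose z := lrnorm r g; rewrite -/z.
have [hw _ _ _] := hA0; have hwn := weight_nnm hw.
(* If both parts have r-th power sums at most lam, then the whole sum is at most 2^r * 2 lam = u^r.
   The factors [D p] undo this change of threshold. *)
pose lam := (u `^ r / 2 `^ (r + 1))%R.
have lam0 : (0 < lam)%R by rewrite divr_gt0 ?powR_gt0.
have lamE (p : R) : (lam `^ (- (p / r)) = D p * u `^ (- p))%R.
  rewrite /lam powRM ?powR_ge0 ?invr_ge0 ?powR_ge0// -powRrM mulrN [(r * _)%R]mulrC divfK ?gt_eqF//.
  by rewrite invr_powRN ?powR_ge0// mulrC.
have hZ := sumpow_nnm r hg; have hz : nnm z by exact: nnm_pow.
pose g0 k x := if u%:E < z x then g k x else 0.
pose g1 k x := if z x <= u%:E then g k x else 0.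
have hg0 k : nnm (g0 k) by apply: nnm_if => //; exact: measurable_gt.
have hg1 k : nnm (g1 k) by apply: nnm_if => //; exact: measurable_le.
have hEg k : nnm (E k (g k)) by exact: condE_nnm.
have hEg0 k : nnm (E k (g0 k)) by exact: condE_nnm.
have hEg1 k : nnm (E k (g1 k)) by exact: condE_nnm.
pose Y := sumpow r (fun k => E k (g k)).
pose Y0 := sumpow r (fun k => E k (g0 k)); pose Y1 := sumpow r (fun k => E k (g1 k)).
have hY : nnm Y by exact: sumpow_nnm.
have hY0 : nnm Y0 by exact: sumpow_nnm.
have hY1 : nnm Y1 by exact: sumpow_nnm.
have YY : {ae P, forall x, Y x <= (2 `^ r)%:E * (Y0 x + Y1 x)}.
  have : {ae P, forall x, forall k, E k (g k) x <= E k (g0 k) x + E k (g1 k) x}.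
    apply: ae_foralln => k.
    have gs x : g k x <= g0 k x + g1 k x.
      by rewrite /g0 /g1; case: ltP => _; rewrite ?adde0 ?add0e.
    have := condE_mono k (hg k) (nnmD (hg0 k) (hg1 k)) (aeW _ gs); apply: filter_app.
    have := condE_add k (hg0 k) (hg1 k); apply: filter_app.
    by apply: aeW => x h1 h2; exact: le_trans h1.
  apply: filter_app; apply: aeW => x hx.
  rewrite /Y /Y0 /Y1 /sumpow -nneseriesD; [|by move=> *; exact: poweR_ge0..].
  rewrite -nneseriesZl; last by move=> k _; rewrite adde_ge0// poweR_ge0.
  apply: lee_nneseries => [k _ _|k _]; first exact: poweR_ge0.
  apply: le_trans (poweR_add_le (ltW r0) ((hEg0 k).2 x) ((hEg1 k).2 x)).
  by apply: le_poweR; [exact: ltW|exact: (hEg k).2|exact: hx].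
have hi (f : T -> \bar R) (c : \bar R) : nnm f -> nnm (fun x => if c < f x then (w x)%:E else 0).
  by move=> hf; apply: nnm_if => //; exact: measurable_gt.
apply: (@le_trans _ _ (\int[P]_x ((if lam%:E < Y0 x then (w x)%:E else 0) +
    (if lam%:E < Y1 x then (w x)%:E else 0)))).
  apply: nnm_le_int.
  - by apply: hi; exact: nnm_pow.
  - by apply: nnmD; exact: hi.
  move: YY; apply: filter_app; apply: aeW => x YYx.
  have w0 := hwn.2 x.
  have s0 : 0 <= (if lam%:E < Y0 x then (w x)%:E else 0) by case: ifP.
  have s1 : 0 <= (if lam%:E < Y1 x then (w x)%:E else 0) by case: ifP.
  case: ifP => [uy|_]; last exact: adde_ge0.
  case: ltP => [_|h0]; first by rewrite leeDl.
  case: ltP => [_|h1]; first by rewrite add0e.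
  exfalso; have : Y x <= (u `^ r)%:E.
    apply: le_trans YYx _.
    apply: (@le_trans _ _ ((2 `^ r)%:E * (lam%:E + lam%:E))).
      by apply: lee_wpmul2l; [rewrite lee_fin powR_ge0|exact: leeD].
    rewrite -EFinD -EFinM lee_fin /lam powRD_gt0// powRr1//.
    rewrite le_eqVlt; apply/orP; left; apply/eqP.
    by field; rewrite gt_eqF// powR_gt0.
  move=> /(le_poweR (ltW (_ : 0 < r^-1)%R) (hY.2 x)); rewrite invr_gt0 => /(_ r0).
  rewrite poweR_EFin -powRrM mulfV ?gt_eqF// powRr1 ?(ltW u0)//.
  by rewrite leNgt uy.
have hi0 := hi Y0 lam%:E hY0; have hi1 := hi Y1 lam%:E hY1.
rewrite ge0_integralD//; [|by move=> x _; exact: hi0.2|exact: hi0.1|by move=> x _; exact: hi1.2|exact: hi1.1].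
have zE (p : R) x : sumpow r g x `^ (p / r) = z x `^ p by rewrite /z /lrnorm -poweRrM mulrC.
apply: leeD.
  apply: le_trans (H0 _ _ hA0 wfin g0 lam hg0 lam0) _.
  have -> : \int[P]_x (sumpow r g0 x `^ (p0 / r) * (w x)%:E) =
      \int[P]_x (if u%:E < z x then z x `^ p0 * (w x)%:E else 0).
    apply: eq_integral => x _; rewrite /sumpow /g0; case: ifP => _; first by rewrite -zE.
    rewrite eseries0; last by move=> k _ _; rewrite poweR0r// gt_eqF.
    by rewrite poweR0r ?mul0e// gt_eqF// divr_gt0// (lt_trans ltr01).
  apply: lee_wpmul2r.
    by apply: integral_ge0 => x _; case: ifP => // _; rewrite mule_ge0 ?poweR_ge0 ?hwn.2.
  rewrite lee_fin lamE mulrA ler_wpM2r ?powR_ge0// /A lerDl mulr_ge0// ltW//.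
apply: le_trans (H1 _ _ hA1 wfin g1 lam hg1 lam0) _.
have -> : \int[P]_x (sumpow r g1 x `^ (p1 / r) * (w x)%:E) =
    \int[P]_x (if z x <= u%:E then z x `^ p1 * (w x)%:E else 0).
  apply: eq_integral => x _; rewrite /sumpow /g1; case: ifP => _; first by rewrite -zE.
  rewrite eseries0; last by move=> k _ _; rewrite poweR0r// gt_eqF.
  by rewrite poweR0r ?mul0e// gt_eqF// divr_gt0// (lt_trans ltr01).
apply: lee_wpmul2r.
  by apply: integral_ge0 => x _; case: ifP => // _; rewrite mule_ge0 ?poweR_ge0 ?hwn.2.
by rewrite lee_fin lamE mulrA ler_wpM2r ?powR_ge0// /A lerDr mulr_ge0// ltW.
Qed.

End conditional_expectation.

(** * The modular inequality *)

Lemma modular_inequality (d : measure_display) (T : measurableType d) (R : realType)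
    (P : probability T R) (F : nat -> set (set T))
    (E : nat -> (T -> \bar R) -> T -> \bar R) (phi : T -> R -> R) (pm pp r q : R) :
  filtration F -> cond_exp_family P F E -> MO_function P phi ->
  unif_lower_type phi pm -> unif_upper_type phi pp ->
  1 <= q -> in_A P E phi q -> q < pm -> pm <= pp -> 1 < r ->
  exists C : R, 0 < C /\ forall (g : nat -> T -> \bar R) (c : R),
    (forall k, nnm (g k)) -> 0 < c -> exists m,
    [/\ nnm m, forall x, (phi_ext phi x (lrnorm r (fun k => E k (g k)) x * c%:E) <= m x)%E &
      (\int[P]_x m x <= C%:E * \int[P]_x phi_ext phi x (lrnorm r g x * c%:E))%E].
Proof.
move=> hF hE hMO [C1 [C10 lo]] [C2 [C20 up]] q1 hq qpm pmpp r1.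
(* A midpoint, taken above r if r < pm and below r otherwise, so that it differs from r. *)
have [p0 [qp0 p0pm p0r]] : exists p0, [/\ q < p0, p0 < pm & p0 != r].
  have [rpm|pmr] := ltP r pm.
    exists ((Num.max q r + pm) / 2).
    have h1 : Num.max q r < pm by rewrite gt_max qpm.
    have h2 : q <= Num.max q r by rewrite le_max lexx.
    have h3 : r <= Num.max q r by rewrite le_max lexx orbT.
    split; last (rewrite gt_eqF//).
    - lra.
    - lra.
    - lra.
  exists ((q + pm) / 2); split; last (rewrite lt_eqF//).
  - lra.
  - lra.
  - lra.
pose p1 := Num.max pp r + 1.
have ppp1 : pp < p1 by rewrite (@le_lt_trans _ _ (Num.max pp r))// ?ltrDl// le_max lexx.
have rp1 : r < p1 by rewrite (@le_lt_trans _ _ (Num.max pp r))// ?ltrDl// le_max lexx orbT.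
have p01 : 1 < p0 by exact: le_lt_trans qp0.
have qp1 : q < p1 by rewrite (lt_trans qpm)// (le_lt_trans pmpp).
have p11 : 1 < p1 by exact: le_lt_trans qp1.
have Apair_ex p : q < p -> exists K : R, 0 < K /\ forall t, 0 < t ->
    Apair P E p K (phi ^~ t) (fun x => phi x t `^ (- (p - 1)^-1)).
  move=> qp; case: hq => [[qE hA]|[hq1 hA]].
    by apply: (Apair_of_A1 hF hE hMO hA); rewrite -qE.
  exact: (Apair_of_Aq hF hE hMO hA).
have [K0 [K00 hA0]] := Apair_ex p0 qp0.
have [K1 [K10 hA1]] := Apair_ex p1 qp1.
have p1r : p1 != r by rewrite gt_eqF.
have [A [A0 hsplit]] := split_bound hF hE p01 p11 r1 p0r p1r K00 K10.
have [C [C0 hint]] := interpolation P p0pm ppp1 (lt_trans ltr01 p11) (ltW A0) C10 C20.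
exists C; split=> // g c hg c0.
have hEg k : nnm (E k (g k)) by exact: (condE_nnm hF hE).
pose y := lrnorm r (fun k => E k (g k)); pose z := lrnorm r g.
have hy : nnm y by exact: lrnorm_nnm.
have hz : nnm z by exact: lrnorm_nnm.
have cn : @nnm _ T R (fun=> c%:E) by apply: nnm_cst; rewrite lee_fin ltW.
have [mono phi0 phioo mphi hphi] := hMO.
have phi_gt0 x t : 0 < t -> 0 < phi x t by move=> t0; have [] := hphi t t0.
apply: (hint phi (fun x => y x * c%:E)%E (fun x => z x * c%:E)%E) => //.
- by move=> x t t0; apply/ltW/phi_gt0.
- move=> x s t s0 st; apply: mono => //; rewrite in_itv/= andbT//.
  exact: le_trans st.
- by move=> t t0; apply: mphi; exact: ltW.
- move=> x M; have /cvgryPge/(_ M) h := phioo x.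
  have [N [_ hN]] := h; exists (Num.max N 0 + 1); split.
    by rewrite ltr_wpDl// le_max lexx orbT.
  by apply: hN; rewrite (@le_lt_trans _ _ (Num.max N 0))// ?ltrDl// le_max lexx.
- exact: nnmM.
- exact: nnmM.
(* The factor c rescales the functions but not the weight: the split bound is used for phi(., t) at
   level t / c, and c^p then moves from (t / c)^-p into the integrand. *)
move=> t t0; have u0 : 0 < t / c by rewrite divr_gt0.
have hw := MO_weight hMO t0.
have := hsplit _ _ _ (hA0 t t0) (hA1 t t0) (MO_int hMO t0) g (t / c) hg u0.
have cE (v : \bar R) : ((t%:E < v * c%:E) = ((t / c)%:E < v))%E.
  by rewrite -lte_pdivrMr// EFinM.
have cE' (v : \bar R) : ((v * c%:E <= t%:E) = (v <= (t / c)%:E))%E.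
  by rewrite !leNgt cE.
have scale (p : R) (b : T -> bool) : measurable_fun setT b ->
    ((A * (t / c) `^ (- p))%:E * \int[P]_x (if b x then z x `^ p * (phi x t)%:E else 0) =
    (A * t `^ (- p))%:E * \int[P]_x (if b x then (z x * c%:E) `^ p * (phi x t)%:E else 0))%E.
  move=> mb.
  have hf : nnm (fun x => if b x then z x `^ p * (phi x t)%:E else 0)%E.
    by apply: nnm_if => //; apply: nnmM; [exact: nnm_pow|exact: weight_nnm].
  rewrite powRM ?invr_ge0 ?(ltW t0) ?(ltW c0)// mulrA EFinM -muleA; congr (_ * _)%E.
  have -> : c^-1 `^ (- p) = c `^ p by rewrite invr_powRN// ltW.
  rewrite -nnm_int_scale ?powR_ge0//; apply: eq_integral => x _.
  case: ifP => _; last by rewrite mule0.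
  by rewrite poweRM ?hz.2 ?lee_fin ?(ltW c0)// poweR_EFin muleAC muleA [in RHS]muleC [in RHS]muleA.
rewrite (scale p0 (fun x => ((t / c)%:E < z x)%E)); last exact: measurable_gt.
rewrite (scale p1 (fun x => (z x <= (t / c)%:E)%E)); last exact: measurable_le.
suff [-> -> ->] : [/\ \int[P]_x (if t%:E < y x * c%:E then (phi x t)%:E else 0) =
      \int[P]_x (if (t / c)%:E < y x then (phi x t)%:E else 0),
    \int[P]_x (if t%:E < z x * c%:E then (z x * c%:E) `^ p0 * (phi x t)%:E else 0) =
      \int[P]_x (if (t / c)%:E < z x then (z x * c%:E) `^ p0 * (phi x t)%:E else 0) &
    \int[P]_x (if z x * c%:E <= t%:E then (z x * c%:E) `^ p1 * (phi x t)%:E else 0) =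
      \int[P]_x (if z x <= (t / c)%:E then (z x * c%:E) `^ p1 * (phi x t)%:E else 0)]%E by [].
by split; apply: eq_integral => x _; rewrite ?cE ?cE'.
Qed.

Unset Implicit Arguments.

(** * The vector-valued inequality *)

Theorem theorem3p14 (d : measure_display) (T : measurableType d) (R : realType)
  (P : probability T R) (F : nat -> set (set T))
  (E : nat -> (T -> \bar R) -> T -> \bar R) (phi : T -> R -> R) (pm pp : R) :
  filtration F -> cond_exp_family P F E ->
  MO_function P phi -> in_A_infty P E phi ->
  unif_lower_type phi pm -> unif_upper_type phi pp ->
  (q_index P E phi < pm%:E)%E -> pm <= pp ->
  forall r : R, 1 < r ->
  exists C : R, 0 < C /\
    forall g : nat -> T -> R,
      (forall k, measurable_fun setT (g k)) -> (forall k x, 0 <= g k x) ->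
      (Lphi_norm P phi
         (fun x => (\sum_(k <oo) (E k (fun y => (g k y)%:E) x) `^ r) `^ r^-1)
       <= C%:E * Lphi_norm P phi
         (fun x => (\sum_(k <oo) ((g k x)%:E) `^ r) `^ r^-1))%E.
Proof.
move=> hF hE hMO _ hlo hup hq pmpp r r1.
have [q [q1 hAq qpm]] : exists q, [/\ 1 <= q, in_A P E phi q & q < pm].
  have /ereal_inf_lt[_ [q [q1 hA] <-]] := hq.
  by rewrite lte_fin => qpm; exists q.
have [C [C0 hmod]] := modular_inequality hF hE hMO hlo hup q1 hAq qpm pmpp r1.
have [C1 [C10 lo]] := hlo.
have [mono phi0 phioo mphi hphi] := hMO.
have pm1 : 1 < pm by exact: le_lt_trans qpm.
(* As pm > 1, D^pm >= D >= C1 C, so that C1 D^-pm C <= 1; and D > 1 permits the lower type at the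
   ratio 1 / D. *)
pose D := C1 * C + 2.
have CC0 : 0 < C1 * C by rewrite mulr_gt0.
have D1 : 1 < D by rewrite /D; lra.
have D0 : 0 < D by exact: lt_trans D1.
pose c := C1 * D^-1 `^ pm.
have c0 : 0 < c by rewrite mulr_gt0// powR_gt0// invr_gt0.
have cC : c * C <= 1.
  have Dpm : D <= D `^ pm by apply: le1r_powR; exact: ltW.
  have -> : c = C1 / D `^ pm.
    by rewrite /c -[D^-1]powR_inv1 ?(ltW D0)// -powRrM mulN1r powRN.
  rewrite mulrAC ler_pdivrMr ?powR_gt0// mul1r (le_trans _ Dpm)// /D; lra.
exists D; split=> // g mg g0.
pose gE k x := (g k x)%:E.
have hg k : nnm (gE k) by exact: nnm_EFin.
(* Each lam admissible on the right makes D * lam admissible on the left. *)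
rewrite -lee_pdivrMl//; apply: le_ereal_inf_tmp => _ [lam [lam0 hlam] <-].
rewrite lee_pdivrMl// -EFinM; apply: ereal_inf_lbound.
exists (D * lam) => //; split; first exact: mulr_gt0.
have lami0 : 0 < lam^-1 by rewrite invr_gt0.
have [m [hm ym mi]] := hmod gE lam^-1 hg lami0.
have hcm : nnm (fun x => c%:E * m x)%E.
  by apply: nnmM => //; apply: nnm_cst; rewrite lee_fin ltW.
have phi_ge0 x t : 0 <= t -> 0 <= phi x t.
  by move=> t0; rewrite -(phi0 x); apply: mono => //; rewrite in_itv/= ?lexx ?t0.
apply: (@le_trans _ _ (\int[P]_x (c%:E * m x))%E).
  apply: lower_integral_mono => x.
    by rewrite /phi_ext; case: (_ * _)%E => [u| |] //; rewrite lee_fin phi_ge0.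
  apply: (@le_trans _ _ (c%:E * phi_ext phi x (lrnorm r (fun k => E k (gE k)) x * lam^-1%:E))%E); last first.
    by apply: lee_wpmul2l; [rewrite lee_fin ltW|exact: ym].
  rewrite -/(lrnorm r (fun k => E k (gE k)) x).
  have : (0 <= lrnorm r (fun k => E k (gE k)) x)%E by exact: poweR_ge0.
  case: (lrnorm _ _ x) => [v| |] // v0; last first.
    by rewrite !gt0_mulye ?lte_fin ?invr_gt0 ?mulr_gt0//= gt0_muley ?lte_fin.
  rewrite /= lee_fin invfM mulrCA normrM gtr0_norm ?invr_gt0//.
  by apply: lo; rewrite ?normr_ge0// invr_gt0 D0/= invf_lt1.
rewrite nnm_int_scale ?(ltW c0)//.
apply: (@le_trans _ _ (c%:E * (C%:E * 1))%E); last by rewrite mule1 -EFinM lee_fin.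
apply: lee_wpmul2l; first by rewrite lee_fin ltW.
by apply: (le_trans mi); apply: lee_wpmul2l; [rewrite lee_fin ltW|exact: hlam].
Qed.
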